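(* Let $f(z)=z+\sum_{n=2}^{\infty}a_nz^n$ belong to $\mathcal{S}^*_{ch}$, and let $\gamma_1=\frac12a_2$ and $\gamma_2=\frac12\big(a_3-\frac12a_2^2\big)$ be its first two logarithmic coefficients. Then $$-\frac{1}{\sqrt6}\le |\gamma_2|-|\gamma_1|\le\frac14.$$ Both inequalities are sharp (each bound is attained by some function in $\mathcal{S}^*_{ch}$).
   Context: $\mathbb{D}=\{z\in\mathbb{C}:|z|<1\}$. $\mathcal{A}$ is the class of analytic $f$ on $\mathbb{D}$ with $f(0)=0$, $f'(0)=1$. For analytic $g,h$ on $\mathbb{D}$, $g\prec h$ means there is an analytic $\omega$ on $\mathbb{D}$ with $\omega(0)=0$, $|\omega(z)|<1$, and $g=h\circ\omega$. $\mathcal{S}^*_{ch}$ is the class of $f\in\mathcal{A}$ with $\frac{zf'(z)}{f(z)}\prec z+\cosh z$ on $\mathbb{D}$. Logarithmic coefficients $\gamma_n$ are defined by $\log\frac{f(z)}{z}=2\sum_{n\ge1}\gamma_nz^n$. *)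

(* Defs.v *)
From Stdlib Require Import Reals.
From Coquelicot Require Import Coquelicot.
Open Scope R_scope.

Definition Cexp (z : C) : C :=
  (exp (Re z) * cos (Im z), exp (Re z) * sin (Im z)).
Definition Ccosh (z : C) : C := ((Cexp z + Cexp (- z)) / 2)%C.

Definition hch (z : C) : C := (z + Ccosh z)%C.

Definition inD (z : C) : Prop := Cmod z < 1.

Definition analytic_on_D (g : C -> C) : Prop :=
  forall z, inD z -> @ex_derive C_AbsRing C_NormedModule g z.

Definition subord (g h : C -> C) : Prop :=
  analytic_on_D g /\
  exists w : C -> C, analytic_on_D w /\ (w 0%C = 0%C) /\
    (forall z, inD z -> Cmod (w z) < 1) /\
    (forall z, inD z -> g z = h (w z)).

Definition in_A (a : nat -> C) (f : C -> C) : Prop :=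
  (a 0%nat = 0%C) /\ (a 1%nat = 1%C) /\
  forall z, inD z ->
    @is_series C_AbsRing C_NormedModule (fun n => (a n * z ^ n)%C) (f z).

(* p is the function z f'(z)/f(z) on the disk (with its removable value
   p(0) = 1 at z = 0); this requires f(z) <> 0 for z in D \ {0} *)
Definition is_zf'_over_f (f p : C -> C) : Prop :=
  (p 0%C = 1%C) /\
  forall z, inD z -> z <> 0%C ->
    (f z <> 0%C) /\
    (exists d : C, @is_derive C_AbsRing C_NormedModule f z d /\ (z * d / f z)%C = p z).

Definition in_Sch (a : nat -> C) (f : C -> C) : Prop :=
  in_A a f /\ exists p : C -> C, is_zf'_over_f f p /\ subord p hch.

Definition gamma1 (a : nat -> C) : C := (a 2%nat / 2)%C.
Definition gamma2 (a : nat -> C) : C := ((a 3%nat - a 2%nat ^ 2 / 2) / 2)%C.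

(* Main.v *)
Require Import Defs.
From Stdlib Require Import Reals Lra Lia ClassicalEpsilon.
From Coquelicot Require Import Coquelicot.
Open Scope R_scope.

(* Write [zf'/f = h(w)] with [h(u) = u + cosh u = 1 + u + u^2/2 + O(u^4)] and
   [w = c1 z + c2 z^2 + O(z^3)], [|w| < 1]. Comparing coefficients, [a_2 = c1] and
   [2 a_3 = c2 + 3/2 c1^2], so [gamma1 = c1/2] and [gamma2 = (c2 + c1^2/2)/4], and both
   bounds are elementary consequences of [|c2| <= 1 - |c1|^2]. Equality holds for
   [w(z) = z (c - z)/(1 - c z)] with [c = 0] and [c = sqrt (2/3)].

   Since [w] is only assumed complex differentiable, the inequality is derived from the mean
   value property on circles about 0, which follows from Goursat's theorem for a rectangle in
   the coordinate [log z]. The extremal [f] is [z g] where [g] solves the linear equation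
   [g' = q g], [q = (h(w) - 1)/z], as a power series. *)

(** * Complex derivatives and the exponential *)

(** The constant [1/sqrt 6] balances two lower bounds. With [x = |c1|], [|gamma2|] is at least 0 and
    at least [(3 x^2 - 2)/8]. After subtracting [x/2], the first bound decreases in [x] and the
    second increases for [x > 2/3]; they meet at [x = sqrt (2/3)] with common value [-1/sqrt 6], and
    there the extremal function has [gamma2 = 0].

    The two directions need different tools. In the inequality, [w] is given only as a
    differentiable function, so it is handled through error terms of order 3 at the origin instead
    of a Taylor series. For the extremal functions, membership in the class demands explicit
    coefficients of [f], so everything there is a power series from the start. The equation
    [y' = q y] then serves twice: it expands [exp] of a power series and it produces [f], so that
    series are never composed and no logarithm is taken. *)

Definition has_cderiv (g : C -> C) (z d : C) : Prop :=
  @is_derive C_AbsRing C_NormedModule g z d.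

Lemma has_cderiv_eps (g : C -> C) (z d : C) :
  has_cderiv g z d <->
  forall eps, 0 < eps -> exists delta, 0 < delta /\
    forall w, Cmod (w - z) < delta ->
      Cmod (g w - g z - d * (w - z)) <= eps * Cmod (w - z).
Proof.
  split.
  - intros [_ H] eps Heps.
    destruct (H z (fun P HP => HP) (mkposreal eps Heps)) as [delta Hd].
    exists delta; split; [apply cond_pos|]. intros w Hw.
    specialize (Hd w Hw). simpl in Hd.
    replace (g w - g z - d * (w - z))%C
      with (minus (minus (g w) (g z)) (scal (minus w z) d)).
    exact Hd.
    unfold minus, scal, plus, opp; simpl. unfold mult; simpl. ring.
  - intros H. split.
    + apply is_linear_scal_l.
    + intros x Hx eps.
      (* The little-o condition ranges over every limit of the neighbourhood filter of [z];
         separation leaves only [z]. *)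
      assert (x = z) as ->.
      { symmetry. apply (@is_filter_lim_locally_unique C_AbsRing (AbsRing_NormedModule C_AbsRing)); exact Hx. }
      destruct (H eps (cond_pos eps)) as (delta & Hd & Hw).
      exists (mkposreal delta Hd). intros y Hy.
      specialize (Hw y Hy).
      replace (g y - g z - d * (y - z))%C
        with (minus (minus (g y) (g z)) (scal (minus y z) d)) in Hw.
      exact Hw.
      unfold minus, scal, plus, opp; simpl. unfold mult; simpl. ring.
Qed.

(** Product and chain rules are stated for the generic module structure of a ring over itself, the
    class through [C_NormedModule]. The two little-o conditions are convertible. *)
Lemma has_cderiv_AbsRing (g : C -> C) (z d : C) :
  has_cderiv g z d <->
  @is_derive C_AbsRing (AbsRing_NormedModule C_AbsRing) g z d.
Proof.
  split; intros [_ H]; (split; [apply is_linear_scal_l|exact H]).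
Qed.

Lemma RtoC_neq_0 (x : R) : x <> 0 -> RtoC x <> 0%C.
Proof. intros H E. apply H. now apply RtoC_inj. Qed.

Lemma has_cderiv_mult (f g : C -> C) (z df dg : C) :
  has_cderiv f z df -> has_cderiv g z dg ->
  has_cderiv (fun t => f t * g t)%C z (df * g z + f z * dg)%C.
Proof.
  intros Hf Hg.
  apply has_cderiv_AbsRing in Hf, Hg. apply has_cderiv_AbsRing.
  exact (@is_derive_mult C_AbsRing f g z df dg Hf Hg Cmult_comm).
Qed.

Lemma has_cderiv_comp (f g : C -> C) (z df dg : C) :
  has_cderiv f (g z) df -> has_cderiv g z dg ->
  has_cderiv (fun t => f (g t)) z (df * dg)%C.
Proof.
  intros Hf Hg. apply has_cderiv_AbsRing in Hg. rewrite Cmult_comm.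
  exact (@is_derive_comp C_AbsRing C_NormedModule f g z df dg Hf Hg).
Qed.

Lemma has_cderiv_plus (f g : C -> C) (z df dg : C) :
  has_cderiv f z df -> has_cderiv g z dg ->
  has_cderiv (fun t => f t + g t)%C z (df + dg)%C.
Proof. intros Hf Hg. exact (is_derive_plus _ _ _ _ _ Hf Hg). Qed.

Lemma has_cderiv_const (c z : C) : has_cderiv (fun _ => c) z 0%C.
Proof. exact (is_derive_const _ _). Qed.

Lemma has_cderiv_id (z : C) : has_cderiv (fun t => t) z 1%C.
Proof. apply has_cderiv_AbsRing. exact (is_derive_id _). Qed.

Lemma has_cderiv_val (f : C -> C) (z d d' : C) :
  d = d' -> has_cderiv f z d -> has_cderiv f z d'.
Proof. now intros ->. Qed.

Lemma has_cderiv_scal (k : C) (f : C -> C) (z d : C) :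
  has_cderiv f z d -> has_cderiv (fun t => k * f t)%C z (k * d)%C.
Proof.
  intros Hf. eapply has_cderiv_val;
    [|apply has_cderiv_mult; [apply has_cderiv_const|exact Hf]]. simpl. ring.
Qed.

Lemma has_cderiv_ext_near (f g : C -> C) (z d : C) (e : R) :
  0 < e -> (forall w, Cmod (w - z) < e -> f w = g w) ->
  has_cderiv f z d -> has_cderiv g z d.
Proof.
  intros He Hfg Hf. rewrite has_cderiv_eps in *. intros eps Heps.
  destruct (Hf eps Heps) as (delta & Hd & H).
  exists (Rmin delta e); split; [now apply Rmin_glb_lt|]. intros w Hw.
  rewrite <- !Hfg.
  - apply H. eapply Rlt_le_trans; [exact Hw|apply Rmin_l].
  - replace (z - z)%C with (RtoC 0) by ring. rewrite Cmod_0; lra.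
  - eapply Rlt_le_trans; [exact Hw|apply Rmin_r].
Qed.

Lemma has_cderiv_inv (z : C) :
  z <> 0%C -> has_cderiv (fun t => / t)%C z (- / (z * z))%C.
Proof.
  intros Hz. apply has_cderiv_eps. intros eps Heps.
  assert (Hm : 0 < Cmod z) by now apply Cmod_gt_0.
  set (m := Cmod z) in *.
  exists (Rmin (m / 2) (eps * m ^ 3 / 2)). split.
  { apply Rmin_glb_lt; [lra|]. assert (0 < m ^ 3) by now apply pow_lt. nra. }
  intros w Hw.
  assert (H1 : Cmod (w - z) < m / 2) by (eapply Rlt_le_trans; [exact Hw|apply Rmin_l]).
  assert (H2 : Cmod (w - z) < eps * m ^ 3 / 2) by (eapply Rlt_le_trans; [exact Hw|apply Rmin_r]).
  assert (Hmw : m / 2 < Cmod w).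
  { pose proof (Cmod_triangle (z - w) w). replace (z - w + w)%C with z in H by ring.
    replace (Cmod (z - w)) with (Cmod (w - z)) in H
      by (rewrite <- Cmod_opp; f_equal; ring). fold m in H. lra. }
  assert (Hw0 : w <> 0%C) by (apply Cmod_gt_0; lra).
  replace (/ w - / z - - / (z * z) * (w - z))%C
    with ((w - z) * (w - z) / (z * z * w))%C by (field; auto).
  rewrite Cmod_div, !Cmod_mult by (repeat apply Cmult_neq_0; auto). fold m.
  pose proof (Cmod_ge_0 (w - z)).
  assert (HP : 0 < m * m * Cmod w) by (repeat apply Rmult_lt_0_compat; lra).
  apply Rmult_le_reg_r with (m * m * Cmod w); [exact HP|].
  unfold Rdiv. rewrite Rmult_assoc, Rinv_l by lra. rewrite Rmult_1_r.
  assert (m ^ 3 / 2 <= m * m * Cmod w).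
  { replace (m ^ 3 / 2) with (m * m * (m / 2)) by (simpl; field).
    apply Rmult_le_compat_l; [nra|lra]. }
  assert (Cmod (w - z) <= eps * (m * m * Cmod w)) by nra.
  nra.
Qed.

(** * Second-order Taylor estimates for the exponential *)

(** The mean value inequality gains one power of [|x|]. The factor [1/(n+1)] of a true integration
    is given up, so one constant serves at every order when the lemma is iterated. *)
Lemma integrate_bound (f df : R -> R) (M x : R) (n : nat) :
  f 0 = 0 -> (forall t, is_derive f t (df t)) ->
  (forall t, Rabs t <= Rabs x -> Rabs (df t) <= M * Rabs t ^ n) -> 0 <= M ->
  Rabs (f x) <= M * Rabs x ^ S n.
Proof.
  intros H0 Hd Hb HM.
  assert (Rabs (f x - f 0) <= M * Rabs x ^ n * Rabs (x - 0)).
  { apply bounded_variation with (dh := df). intros t Ht.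
    rewrite !Rminus_0_r in Ht. split; [apply Hd|].
    eapply Rle_trans; [now apply Hb|]. apply Rmult_le_compat_l; [lra|].
    apply pow_incr. split; [apply Rabs_pos|exact Ht]. }
  rewrite H0, !Rminus_0_r in H. simpl. lra.
Qed.

Lemma exp_taylor2 (x : R) :
  Rabs x <= 1 -> Rabs (exp x - 1 - x - x ^ 2 / 2) <= 3 * Rabs x ^ 3.
Proof.
  intros Hx.
  assert (E1 : forall t, Rabs t <= 1 -> Rabs (exp t - 1) <= 3 * Rabs t ^ 1).
  { intros t Ht. apply (integrate_bound (fun t => exp t - 1) exp); [|intros s; auto_derive; auto; ring| |lra].
    rewrite exp_0; ring.
    intros s Hs. rewrite Rabs_pos_eq by (left; apply exp_pos).
    simpl. rewrite Rmult_1_r. apply Rle_trans with (exp 1); [|apply exp_le_3].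
    apply Rabs_le_between in Ht. pose proof (Rle_abs s).
    assert (s <= 1) by (unfold Rabs in *; destruct (Rcase_abs t); lra).
    destruct H0; [left; now apply exp_increasing|right; now f_equal]. }
  assert (E2 : forall t, Rabs t <= 1 -> Rabs (exp t - 1 - t) <= 3 * Rabs t ^ 2).
  { intros t Ht. apply (integrate_bound (fun t => exp t - 1 - t) (fun t => exp t - 1));
      [|intros s; auto_derive; auto; ring| |lra].
    rewrite exp_0; ring. intros s Hs. apply E1. lra. }
  apply (integrate_bound (fun t => exp t - 1 - t - t ^ 2 / 2) (fun t => exp t - 1 - t));
      [|intros s; auto_derive; auto; field| |lra].
  rewrite exp_0; field. intros s Hs. apply E2. lra.
Qed.

Lemma sin_cos_taylor (x : R) :
  Rabs (sin x - x) <= 1 * Rabs x ^ 3 /\ Rabs (cos x - 1 + x ^ 2 / 2) <= 1 * Rabs x ^ 4.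
Proof.
  assert (S1 : forall t, Rabs (sin t) <= 1 * Rabs t ^ 1).
  { intros t. apply (integrate_bound sin cos); [apply sin_0|intros s; auto_derive; auto; ring| |lra].
    intros s _. simpl. rewrite Rmult_1_r. apply Rabs_le. apply COS_bound. }
  assert (C1 : forall t, Rabs (cos t - 1) <= 1 * Rabs t ^ 2).
  { intros t. apply (integrate_bound (fun t => cos t - 1) (fun t => - sin t));
      [rewrite cos_0; ring|intros s; auto_derive; auto; ring| |lra].
    intros s _. rewrite Rabs_Ropp. apply S1. }
  assert (S2 : forall t, Rabs (sin t - t) <= 1 * Rabs t ^ 3).
  { intros t. apply (integrate_bound (fun t => sin t - t) (fun t => cos t - 1));
      [rewrite sin_0; ring|intros s; auto_derive; auto; ring| |lra].
    intros s _. apply C1. }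
  split; [apply S2|].
  apply (integrate_bound (fun t => cos t - 1 + t ^ 2 / 2) (fun t => - sin t + t));
      [rewrite cos_0; field|intros s; auto_derive; auto; field| |lra].
  intros s _. replace (- sin s + s) with (- (sin s - s)) by ring. rewrite Rabs_Ropp. apply S2.
Qed.

Lemma Cmod_le_Re_Im (z : C) : Cmod z <= Rabs (Re z) + Rabs (Im z).
Proof.
  destruct z as [x y].
  replace (x, y) with (RtoC x + Ci * RtoC y)%C
    by (unfold RtoC, Ci, Cplus, Cmult; simpl; f_equal; ring).
  eapply Rle_trans; [apply Cmod_triangle|].
  rewrite Cmod_mult, Cmod_Ci, !Cmod_R. simpl.
  rewrite !Rmult_0_l, !Rplus_0_l, !Rmult_1_l, Rminus_0_r, Rplus_0_r. lra.
Qed.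

Lemma Im_le_Cmod (z : C) : Rabs (Im z) <= Cmod z.
Proof. eapply Rle_trans; [apply Rmax_r|apply Rmax_Cmod]. Qed.

Lemma Cexp_taylor2 (w : C) :
  Cmod w <= 1 -> Cmod (Cexp w - 1 - w - w * w / 2) <= 20 * Cmod w ^ 3.
Proof.
  destruct w as [x y]. intros Hw. set (r := Cmod (x, y)) in *.
  pose proof (re_le_Cmod (x, y)) as Hx. pose proof (Im_le_Cmod (x, y)) as Hy.
  simpl in Hx, Hy. fold r in Hx, Hy.
  destruct (sin_cos_taylor y) as [Hs Hc]. pose proof (exp_taylor2 x ltac:(lra)) as He.
  assert (Hr : 0 <= r) by apply Cmod_ge_0.
  assert (R3 : forall t, Rabs t <= r -> Rabs t ^ 3 <= r ^ 3)
    by (intros t Ht; apply pow_incr; split; [apply Rabs_pos|exact Ht]).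
  assert (R4 : Rabs y ^ 4 <= r ^ 3).
  { pose proof (Rabs_pos y). pose proof (R3 y Hy).
    assert (0 <= Rabs y ^ 3) by now apply pow_le. simpl in *. nra. }
  pose proof (R3 x Hx). pose proof (R3 y Hy).
  set (e := exp x - 1 - x - x ^ 2 / 2) in *.
  set (c := cos y - 1 + y ^ 2 / 2) in *. set (s := sin y - y) in *.
  assert (Ee : exp x = 1 + x + x ^ 2 / 2 + e) by (unfold e; ring).
  assert (Ec : cos y = 1 - y ^ 2 / 2 + c) by (unfold c; ring).
  assert (Es : sin y = y + s) by (unfold s; ring).
  assert (Hex : Rabs (exp x) <= 3).
  { rewrite Rabs_pos_eq by (left; apply exp_pos). apply Rle_trans with (exp 1); [|apply exp_le_3].
    pose proof (Rle_abs x). assert (x <= 1) by lra.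
    destruct H2; [left; now apply exp_increasing|right; now f_equal]. }
  eapply Rle_trans; [apply Cmod_le_Re_Im|].
  (* Once the real remainders [e], [c], [s] are substituted, the terms of degree at most 2 cancel
     and only products of degree at least 3 remain. Each of the two parts is at most [8 r^3], well
     within the constant 20. *)
  assert (ER : Re (Cexp (x, y) - 1 - (x, y) - (x, y) * (x, y) / 2)%C
     = e * cos y + (1 + x + x ^ 2 / 2) * c + (- x * (y ^ 2 / 2) - x ^ 2 / 2 * (y ^ 2 / 2))).
  { unfold Cexp. simpl. rewrite Ee, Ec. field. }
  assert (EI : Im (Cexp (x, y) - 1 - (x, y) - (x, y) * (x, y) / 2)%C
     = e * sin y + (1 + x + x ^ 2 / 2) * s + x ^ 2 / 2 * y).
  { unfold Cexp. simpl. rewrite Ee, Es. field. }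
  rewrite ER, EI.
  assert (0 <= r ^ 3) by now apply pow_le.
  assert (Hpoly : Rabs (1 + x + x ^ 2 / 2) <= 5 / 2).
  { apply Rabs_le_between in Hx. apply Rabs_le. simpl. nra. }
  assert (B1 : forall u v k l, Rabs u <= k * r ^ 3 -> Rabs v <= l -> 0 <= l -> 0 <= k ->
     Rabs (u * v) <= k * l * r ^ 3).
  { intros u v k l Hu Hv Hl Hk. rewrite Rabs_mult. pose proof (Rabs_pos u). pose proof (Rabs_pos v).
    replace (k * l * r ^ 3) with ((k * r ^ 3) * l) by ring. apply Rmult_le_compat; auto. }
  assert (Hx1 : Rabs x <= 1) by lra. assert (Hy1 : Rabs y <= 1) by lra.
  assert (C3 : forall u v w, Rabs u <= r -> Rabs v <= r -> Rabs w <= r -> Rabs (u * v * w) <= r ^ 3).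
  { intros u v w Hu Hv Hww. rewrite !Rabs_mult. pose proof (Rabs_pos u). pose proof (Rabs_pos v).
    pose proof (Rabs_pos w). replace (r ^ 3) with (r * r * r) by ring.
    apply Rmult_le_compat; auto. now apply Rmult_le_pos. apply Rmult_le_compat; auto. }
  pose proof (COS_bound y). pose proof (SIN_bound y).
  assert (T1 : Rabs (e * cos y) <= 3 * 1 * r ^ 3).
  { apply B1; try lra. apply Rabs_le; lra. }
  assert (T2 : Rabs (c * (1 + x + x ^ 2 / 2)) <= 1 * (5/2) * r ^ 3) by (apply B1; lra).
  assert (T3 : Rabs (e * sin y) <= 3 * 1 * r ^ 3).
  { apply B1; try lra. apply Rabs_le; lra. }
  assert (T4 : Rabs (s * (1 + x + x ^ 2 / 2)) <= 1 * (5/2) * r ^ 3) by (apply B1; lra).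
  assert (T5 : Rabs (x * y * y) <= r ^ 3) by now apply C3.
  assert (T6 : Rabs (x * y * y * x) <= 1 * 1 * r ^ 3) by (apply B1; lra).
  assert (T7 : Rabs (x * x * y) <= r ^ 3) by now apply C3.
  apply Rabs_le_between in T1, T2, T3, T4, T5, T6, T7.
  match goal with |- Rabs ?a + Rabs ?b <= _ =>
    assert (Rabs a <= 8 * r ^ 3) by (apply Rabs_le; simpl in *; lra);
    assert (Rabs b <= 8 * r ^ 3) by (apply Rabs_le; simpl in *; lra) end.
  lra.
Qed.

Lemma Cexp_add (z w : C) : Cexp (z + w) = (Cexp z * Cexp w)%C.
Proof.
  destruct z as [a b], w as [c d]. unfold Cexp, Cmult. simpl.
  rewrite exp_plus, cos_plus, sin_plus. f_equal; ring.
Qed.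

Lemma Cexp_0 : Cexp 0 = 1%C.
Proof. unfold Cexp, RtoC; simpl. rewrite exp_0, cos_0, sin_0. f_equal; ring. Qed.

(** By [Cexp_add] the claim reduces to the origin, where the Taylor estimate gives
    [|Cexp h - 1 - h| <= 21 |h|^2]: 20 from the remainder, at most 1 from [h^2/2]. *)
Lemma Cexp_deriv (z : C) : has_cderiv Cexp z (Cexp z).
Proof.
  apply has_cderiv_eps. intros eps Heps.
  set (m := Cmod (Cexp z)). assert (0 <= m) by apply Cmod_ge_0.
  exists (Rmin 1 (eps / (21 * (m + 1)))). split.
  { apply Rmin_glb_lt; [lra|]. apply Rdiv_lt_0_compat; nra. }
  intros w Hw. set (h := (w - z)%C) in *.
  assert (H1 : Cmod h < 1) by (eapply Rlt_le_trans; [exact Hw|apply Rmin_l]).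
  assert (H2 : Cmod h < eps / (21 * (m + 1))) by (eapply Rlt_le_trans; [exact Hw|apply Rmin_r]).
  replace w with (z + h)%C by (unfold h; ring). rewrite Cexp_add.
  replace (Cexp z * Cexp h - Cexp z - Cexp z * h)%C with (Cexp z * (Cexp h - 1 - h))%C by ring.
  rewrite Cmod_mult. fold m.
  pose proof (Cexp_taylor2 h ltac:(lra)) as T.
  pose proof (Cmod_triangle (Cexp h - 1 - h - h * h / 2) (h * h / 2)) as T2.
  replace (Cexp h - 1 - h - h * h / 2 + h * h / 2)%C with (Cexp h - 1 - h)%C in T2 by ring.
  unfold Cdiv in T2. rewrite !Cmod_mult, Cmod_inv, Cmod_R, (Rabs_pos_eq 2) in T2
    by (try lra; apply RtoC_neq_0; lra).
  pose proof (Cmod_ge_0 h). set (k := Cmod h) in *.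
  assert (Cmod (Cexp h - 1 - h) <= 21 * k * k) by (simpl in T; unfold Cdiv in T; nra).
  assert (21 * (m + 1) * k < eps).
  { apply (Rmult_lt_compat_r (21 * (m + 1))) in H2; [|nra].
    unfold Rdiv in H2. rewrite Rmult_assoc, Rinv_l in H2 by nra. lra. }
  pose proof (Cmod_ge_0 (Cexp h - 1 - h)). nra.
Qed.

Lemma hch_taylor2 (w : C) :
  Cmod w <= 1 -> Cmod (hch w - 1 - w - w * w / 2) <= 20 * Cmod w ^ 3.
Proof.
  intros Hw. unfold hch, Ccosh.
  pose proof (Cexp_taylor2 w Hw) as H1.
  pose proof (Cexp_taylor2 (- w) ltac:(rewrite Cmod_opp; lra)) as H2.
  rewrite Cmod_opp in H2.
  replace (w + (Cexp w + Cexp (- w)) / 2 - 1 - w - w * w / 2)%C with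
    (/ 2 * ((Cexp w - 1 - w - w * w / 2) + (Cexp (- w) - 1 - - w - - w * - w / 2)))%C.
  2: field.
  rewrite Cmod_mult, Cmod_inv, Cmod_R, (Rabs_pos_eq 2) by (try lra; apply RtoC_neq_0; lra).
  eapply Rle_trans. apply Rmult_le_compat_l. lra. apply Cmod_triangle. lra.
Qed.

(** * Goursat's theorem for closed 1-forms *)

Lemma nested_intervals (u v : nat -> R) :
  (forall n, u n <= u (S n)) -> (forall n, v (S n) <= v n) ->
  is_lim_seq (fun n => v n - u n) 0 ->
  exists x, forall n, u n <= x <= v n.
Proof.
  intros Hu Hv Huv.
  destruct (ex_lim_seq_adj u v Hu Hv Huv) as ([l Hl] & [l' Hl'] & E).
  rewrite (is_lim_seq_unique _ _ Hl), (is_lim_seq_unique _ _ Hl') in E.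
  injection E as <-. exists l. intros n. split.
  - exact (is_lim_seq_incr_compare u l Hl Hu n).
  - exact (is_lim_seq_decr_compare v l Hl' Hv n).
Qed.

Lemma lim_half_pow (L : R) : is_lim_seq (fun n => L * (/ 2) ^ n) 0.
Proof.
  replace (Finite 0) with (Rbar_mult L 0) by (simpl; f_equal; ring).
  apply is_lim_seq_scal_l, is_lim_seq_geom. rewrite Rabs_pos_eq; lra.
Qed.

(** Kept abstract in [B], so that Goursat's argument only has to supply a lower bound inherited by
    some quarter. The clause [a < b -> a' < b'] keeps the small rectangles from collapsing, which
    the final strict inequality requires. *)
Lemma rectangle_bisection (B : R -> R -> R -> R -> Prop) (a b c d : R) :
  a <= b -> c <= d -> B a b c d ->
  (forall a' b' c' d', a <= a' <= b' -> b' <= b -> c <= c' <= d' -> d' <= d ->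
    B a' b' c' d' ->
    let m := (a' + b') / 2 in let n := (c' + d') / 2 in
    B a' m c' n \/ B m b' c' n \/ B a' m n d' \/ B m b' n d') ->
  exists x y, forall delta, 0 < delta -> exists a' b' c' d',
    a <= a' <= x /\ x <= b' <= b /\ c <= c' <= y /\ y <= d' <= d /\
    b' - a' < delta /\ d' - c' < delta /\
    (a < b -> a' < b') /\ B a' b' c' d'.
Proof.
  intros Hab Hcd HB Hsplit.
  set (L := b - a). set (M := d - c).
  (* Only lower-left corners are stored, the sides at stage [k] being [L/2^k] and [M/2^k]. [next]
     tests three quarters by excluded middle and falls back on the fourth, which [Hsplit] then
     justifies. *)
  set (cell k p := B (fst p) (fst p + L * (/ 2) ^ k) (snd p) (snd p + M * (/ 2) ^ k)).
  set (next k (p : R * R) :=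
    let h := L * (/ 2) ^ S k in let v := M * (/ 2) ^ S k in
    if excluded_middle_informative (cell (S k) p) then p
    else if excluded_middle_informative (cell (S k) (fst p + h, snd p)) then (fst p + h, snd p)
    else if excluded_middle_informative (cell (S k) (fst p, snd p + v)) then (fst p, snd p + v)
    else (fst p + h, snd p + v)).
  set (s := nat_rect (fun _ => (R * R)%type) (a, c) next).
  assert (Hs : forall k, s (S k) = next k (s k)) by reflexivity.
  assert (Hpow : forall k, 0 < (/ 2) ^ k) by (intros k; apply pow_lt; lra).
  assert (HL : forall k, 0 <= L * (/ 2) ^ k)
    by (intros k; apply Rmult_le_pos; [unfold L; lra|left; apply Hpow]).
  assert (HM : forall k, 0 <= M * (/ 2) ^ k)
    by (intros k; apply Rmult_le_pos; [unfold M; lra|left; apply Hpow]).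
  assert (HLS : forall k, L * (/ 2) ^ k = 2 * (L * (/ 2) ^ S k)) by (intros k; simpl; field).
  assert (HMS : forall k, M * (/ 2) ^ k = 2 * (M * (/ 2) ^ S k)) by (intros k; simpl; field).
  assert (Hnext : forall k p,
    (fst (next k p) = fst p \/ fst (next k p) = fst p + L * (/ 2) ^ S k) /\
    (snd (next k p) = snd p \/ snd (next k p) = snd p + M * (/ 2) ^ S k)).
  { intros k p. unfold next.
    repeat destruct excluded_middle_informative; simpl; auto. }
  assert (Hmono : forall k, fst (s k) <= fst (s (S k)) /\
      fst (s (S k)) + L * (/ 2) ^ S k <= fst (s k) + L * (/ 2) ^ k /\
      snd (s k) <= snd (s (S k)) /\
      snd (s (S k)) + M * (/ 2) ^ S k <= snd (s k) + M * (/ 2) ^ k).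
  { intros k. rewrite Hs. destruct (Hnext k (s k)) as [H1 H2].
    pose proof (HL (S k)). pose proof (HM (S k)). rewrite (HLS k), (HMS k).
    destruct H1 as [-> | ->], H2 as [-> | ->]; lra. }
  assert (Hin : forall k, a <= fst (s k) /\ fst (s k) + L * (/ 2) ^ k <= b /\
      c <= snd (s k) /\ snd (s k) + M * (/ 2) ^ k <= d).
  { induction k as [|k IH]; [simpl; unfold L, M; lra|].
    destruct (Hmono k) as (? & ? & ? & ?). lra. }
  assert (Hcell : forall k, cell k (s k)).
  { induction k as [|k IH].
    - unfold cell. simpl. replace (a + L * 1) with b by (unfold L; ring).
      replace (c + M * 1) with d by (unfold M; ring). exact HB.
    - rewrite Hs. unfold next.
      destruct (Hin k) as (? & ? & ? & ?). pose proof (HL k). pose proof (HM k).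
      assert (Hk := Hsplit (fst (s k)) (fst (s k) + L * (/ 2) ^ k) (snd (s k))
        (snd (s k) + M * (/ 2) ^ k) ltac:(lra) ltac:(lra) ltac:(lra) ltac:(lra) IH).
      cbv zeta in Hk.
      replace ((fst (s k) + (fst (s k) + L * (/ 2) ^ k)) / 2)
        with (fst (s k) + L * (/ 2) ^ S k) in Hk by (simpl; field).
      replace ((snd (s k) + (snd (s k) + M * (/ 2) ^ k)) / 2)
        with (snd (s k) + M * (/ 2) ^ S k) in Hk by (simpl; field).
      replace (fst (s k) + L * (/ 2) ^ k)
        with (fst (s k) + L * (/ 2) ^ S k + L * (/ 2) ^ S k) in Hk by (simpl; field).
      replace (snd (s k) + M * (/ 2) ^ k)
        with (snd (s k) + M * (/ 2) ^ S k + M * (/ 2) ^ S k) in Hk by (simpl; field).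
      cbv zeta.
      destruct excluded_middle_informative as [N1|N1]; [exact N1|].
      destruct excluded_middle_informative as [N2|N2]; [exact N2|].
      destruct excluded_middle_informative as [N3|N3]; [exact N3|].
      unfold cell in *. cbn [fst snd] in *. tauto. }
  destruct (nested_intervals (fun k => fst (s k)) (fun k => fst (s k) + L * (/ 2) ^ k))
    as [x Hx].
  { intros n. apply Hmono. }
  { intros n. apply Hmono. }
  { eapply is_lim_seq_ext; [|apply (lim_half_pow L)]. intros n; simpl; ring. }
  destruct (nested_intervals (fun k => snd (s k)) (fun k => snd (s k) + M * (/ 2) ^ k))
    as [y Hy].
  { intros n. apply Hmono. }
  { intros n. apply Hmono. }
  { eapply is_lim_seq_ext; [|apply (lim_half_pow M)]. intros n; simpl; ring. }
  exists x, y. intros delta Hdelta.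
  pose proof (lim_half_pow (L + M)) as Hlim. apply is_lim_seq_spec in Hlim.
  destruct (Hlim (mkposreal delta Hdelta)) as [k Hk].
  specialize (Hk k (le_n k)). simpl in Hk. rewrite Rminus_0_r in Hk.
  apply Rabs_def2 in Hk.
  exists (fst (s k)), (fst (s k) + L * (/ 2) ^ k), (snd (s k)), (snd (s k) + M * (/ 2) ^ k).
  destruct (Hin k) as (? & ? & ? & ?). pose proof (HL k). pose proof (HM k).
  specialize (Hx k). specialize (Hy k). simpl in Hx, Hy.
  repeat split; try lra.
  - intros Hlt. specialize (Hpow k). assert (0 < L) by (unfold L; lra). nra.
  - apply Hcell.
Qed.

(* The 1-form [P dx + Q dy] is differentiable and closed at [(x, y)]. *)
Definition closed_at (P Q : R -> R -> R) (x y : R) : Prop :=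
  exists alpha beta gamma, forall eps, 0 < eps -> exists delta, 0 < delta /\
    forall x' y', Rabs (x' - x) < delta -> Rabs (y' - y) < delta ->
      Rabs (P x' y' - P x y - alpha * (x' - x) - beta * (y' - y))
        <= eps * (Rabs (x' - x) + Rabs (y' - y)) /\
      Rabs (Q x' y' - Q x y - beta * (x' - x) - gamma * (y' - y))
        <= eps * (Rabs (x' - x) + Rabs (y' - y)).

Lemma affine_error_continuous (f : R -> R) (x k : R) :
  (forall eps, 0 < eps -> exists delta, 0 < delta /\
    forall x', Rabs (x' - x) < delta ->
      Rabs (f x' - f x - k * (x' - x)) <= eps * Rabs (x' - x)) ->
  continuous f x.
Proof.
  intros H. apply (@ex_derive_continuous R_AbsRing R_NormedModule). exists k.
  apply is_derive_Reals. intros eps Heps.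
  destruct (H (eps / 2) ltac:(lra)) as (delta & Hd & Hx).
  exists (mkposreal delta Hd). intros h Hh Hhd. simpl in Hhd.
  specialize (Hx (x + h)). replace (x + h - x) with h in Hx by ring.
  specialize (Hx Hhd).
  assert (0 < Rabs h) by now apply Rabs_pos_lt.
  replace ((f (x + h) - f x) / h - k) with ((f (x + h) - f x - k * h) / h) by now field.
  unfold Rdiv. rewrite Rabs_mult, Rabs_inv.
  apply Rmult_lt_reg_r with (Rabs h); [assumption|].
  rewrite Rmult_assoc, Rinv_l by lra. nra.
Qed.

Lemma closed_at_continuous (P Q : R -> R -> R) (x y : R) :
  closed_at P Q x y ->
  continuous (fun t => P t y) x /\ continuous (fun t => Q x t) y.
Proof.
  intros (al & be & ga & H). split.
  - apply affine_error_continuous with al. intros eps Heps.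
    destruct (H eps Heps) as (delta & Hd & Hx). exists delta; split; [exact Hd|].
    intros x' Hx'. destruct (Hx x' y Hx') as [H1 _].
    { rewrite Rminus_diag, Rabs_R0; exact Hd. }
    rewrite Rminus_diag, Rabs_R0, Rmult_0_r, Rminus_0_r, Rplus_0_r in H1. exact H1.
  - apply affine_error_continuous with ga. intros eps Heps.
    destruct (H eps Heps) as (delta & Hd & Hx). exists delta; split; [exact Hd|].
    intros y' Hy'. destruct (Hx x y') as [_ H1]; [|exact Hy'|].
    { rewrite Rminus_diag, Rabs_R0; exact Hd. }
    rewrite Rminus_diag, Rabs_R0, Rmult_0_r, Rminus_0_r, Rplus_0_l in H1. exact H1.
Qed.

Lemma RInt_near_const (f : R -> R) (a b k e : R) :
  a <= b -> ex_RInt f a b -> (forall x, a <= x <= b -> Rabs (f x - k) <= e) ->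
  Rabs (RInt f a b - k * (b - a)) <= e * (b - a).
Proof.
  intros Hab Hf He.
  assert (Hc : ex_RInt (fun _ => k) a b) by apply ex_RInt_const.
  replace (RInt f a b - k * (b - a)) with (RInt (fun x => f x - k) a b).
  - rewrite Rmult_comm. apply abs_RInt_le_const; auto.
    exact (ex_RInt_minus _ _ _ _ Hf Hc).
  - etransitivity; [exact (RInt_minus _ _ _ _ Hf Hc)|].
    rewrite RInt_const. unfold minus, plus, opp, scal; simpl. unfold mult; simpl. ring.
Qed.

(* The integral of [P dx + Q dy] along the boundary of [[a, b] x [c, d]], counterclockwise. *)
Definition boundary_integral (P Q : R -> R -> R) (a b c d : R) : R :=
  RInt (fun x => P x c - P x d) a b + RInt (fun y => Q b y - Q a y) c d.

Lemma ex_RInt_sides (P Q : R -> R -> R) (a b c d : R) :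
  (forall x y, a <= x <= b -> c <= y <= d -> closed_at P Q x y) ->
  (forall a' b' y, a <= a' <= b' -> b' <= b -> c <= y <= d -> ex_RInt (fun x => P x y) a' b') /\
  (forall c' d' x, c <= c' <= d' -> d' <= d -> a <= x <= b -> ex_RInt (fun y => Q x y) c' d').
Proof.
  intros H. split.
  - intros a' b' y Ha Hb Hy. apply (@ex_RInt_continuous R_CompleteNormedModule).
    intros x Hx. rewrite Rmin_left, Rmax_right in Hx by lra.
    apply (closed_at_continuous P Q). apply H; lra.
  - intros c' d' x Hc Hd Hx. apply (@ex_RInt_continuous R_CompleteNormedModule).
    intros y Hy. rewrite Rmin_left, Rmax_right in Hy by lra.
    apply (closed_at_continuous P Q). apply H; lra.
Qed.

Lemma boundary_integral_sides (P Q : R -> R -> R) (a b c d : R) :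
  (forall y, c <= y <= d -> ex_RInt (fun x => P x y) a b) ->
  (forall x, a <= x <= b -> ex_RInt (fun y => Q x y) c d) ->
  a <= b -> c <= d ->
  boundary_integral P Q a b c d =
    RInt (fun x => P x c) a b - RInt (fun x => P x d) a b
    + (RInt (fun y => Q b y) c d - RInt (fun y => Q a y) c d).
Proof.
  intros HP HQ Hab Hcd. unfold boundary_integral. f_equal.
  - apply (RInt_minus (fun x => P x c) (fun x => P x d)); apply HP; lra.
  - apply (RInt_minus (fun y => Q b y) (fun y => Q a y)); apply HQ; lra.
Qed.

(** Each interior edge is traversed twice in opposite directions, so its contributions cancel. *)
Lemma boundary_integral_split (P Q : R -> R -> R) (a b c d m n : R) :
  (forall x y, a <= x <= b -> c <= y <= d -> closed_at P Q x y) ->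
  a <= m <= b -> c <= n <= d ->
  boundary_integral P Q a b c d =
    boundary_integral P Q a m c n + boundary_integral P Q m b c n
    + (boundary_integral P Q a m n d + boundary_integral P Q m b n d).
Proof.
  intros H Hm Hn. destruct (ex_RInt_sides P Q a b c d H) as [HP HQ].
  assert (HJ : forall a' b' c' d', a <= a' <= b' -> b' <= b -> c <= c' <= d' -> d' <= d ->
    boundary_integral P Q a' b' c' d' =
      RInt (fun x => P x c') a' b' - RInt (fun x => P x d') a' b'
      + (RInt (fun y => Q b' y) c' d' - RInt (fun y => Q a' y) c' d')).
  { intros a' b' c' d' Ha Hb Hc Hd. apply boundary_integral_sides; [| |lra|lra].
    - intros y Hy. apply HP; lra.
    - intros x Hx. apply HQ; lra. }
  rewrite !HJ by lra.
  rewrite <- (RInt_Chasles (fun x => P x c) a m b) by (apply HP; lra).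
  rewrite <- (RInt_Chasles (fun x => P x d) a m b) by (apply HP; lra).
  rewrite <- (RInt_Chasles (fun y => Q b y) c n d) by (apply HQ; lra).
  rewrite <- (RInt_Chasles (fun y => Q a y) c n d) by (apply HQ; lra).
  unfold plus; simpl. ring.
Qed.

(** A nonzero integral stays, along nested quarters, at least a fixed multiple of the squared
    half-perimeter. Near the limit point the affine part of the form integrates to zero, and the
    differentiability error is a smaller multiple of the same square. *)
Lemma goursat_rectangle (P Q : R -> R -> R) (a b c d : R) :
  a < b -> c < d ->
  (forall x y, a <= x <= b -> c <= y <= d -> closed_at P Q x y) ->
  boundary_integral P Q a b c d = 0.
Proof.
  intros Hab Hcd H. apply NNPP. intros Hne.
  set (J := boundary_integral P Q) in *.
  (* Halving the sides divides the square by 4, exactly the share that one of four quarters must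
     carry. *)
  set (eta := Rabs (J a b c d) / (b - a + (d - c)) ^ 2).
  assert (Hs : 0 < (b - a + (d - c)) ^ 2) by (apply pow_lt; lra).
  assert (Heta : 0 < eta) by (apply Rdiv_lt_0_compat; [now apply Rabs_pos_lt|exact Hs]).
  destruct (rectangle_bisection
    (fun a' b' c' d' => eta * (b' - a' + (d' - c')) ^ 2 <= Rabs (J a' b' c' d')) a b c d)
    as (x & y & Hxy); try lra.
  - unfold eta, Rdiv. rewrite Rmult_assoc, Rinv_l by lra. lra.
  - intros a' b' c' d' Ha Hb Hc Hd HB m n.
    assert (E : J a' b' c' d' = J a' m c' n + J m b' c' n + (J a' m n d' + J m b' n d')).
    { apply boundary_integral_split; [|unfold m; lra|unfold n; lra].
      intros; apply H; lra. }
    destruct (Rle_dec (eta * (m - a' + (n - c')) ^ 2) (Rabs (J a' m c' n))); [tauto|].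
    destruct (Rle_dec (eta * (b' - m + (n - c')) ^ 2) (Rabs (J m b' c' n))); [tauto|].
    destruct (Rle_dec (eta * (m - a' + (d' - n)) ^ 2) (Rabs (J a' m n d'))); [tauto|].
    destruct (Rle_dec (eta * (b' - m + (d' - n)) ^ 2) (Rabs (J m b' n d'))); [tauto|].
    exfalso. rewrite E in HB.
    pose proof (Rabs_triang (J a' m c' n + J m b' c' n) (J a' m n d' + J m b' n d')).
    pose proof (Rabs_triang (J a' m c' n) (J m b' c' n)).
    pose proof (Rabs_triang (J a' m n d') (J m b' n d')).
    set (q := eta * ((b' - a' + (d' - c')) / 2) ^ 2).
    replace (eta * (m - a' + (n - c')) ^ 2) with q in * by (unfold q, m, n; field).
    replace (eta * (b' - m + (n - c')) ^ 2) with q in * by (unfold q, m, n; field).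
    replace (eta * (m - a' + (d' - n)) ^ 2) with q in * by (unfold q, m, n; field).
    replace (eta * (b' - m + (d' - n)) ^ 2) with q in * by (unfold q, m, n; field).
    replace (eta * (b' - a' + (d' - c')) ^ 2) with (4 * q) in * by (unfold q; field).
    lra.
  - assert (Hin : a <= x <= b /\ c <= y <= d).
    { destruct (Hxy 1 Rlt_0_1) as (a' & b' & c' & d' & H'). lra. }
    destruct (H x y ltac:(lra) ltac:(lra)) as (al & be & ga & Hd).
    (* Two opposite sides contribute [eta/8 * s] each, hence a total of [eta/4 * s^2], strictly
       below the inherited [eta * s^2]. *)
    destruct (Hd (eta / 8) ltac:(lra)) as (delta & Hdelta & Hclose).
    destruct (Hxy delta Hdelta) as
      (a' & b' & c' & d' & Ha & Hb & Hc & Hd' & Hh & Hv & Hpos & HB).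
    specialize (Hpos Hab).
    destruct (ex_RInt_sides P Q a b c d H) as [HP HQ].
    set (s := b' - a' + (d' - c')) in *.
    assert (Hfar : forall x' y', a' <= x' <= b' -> c' <= y' <= d' ->
      Rabs (x' - x) < delta /\ Rabs (y' - y) < delta /\
      Rabs (x' - x) + Rabs (y' - y) <= s).
    { intros x' y' Hx' Hy'. unfold s, Rabs.
      destruct (Rcase_abs (x' - x)), (Rcase_abs (y' - y)); lra. }
    (* The [al] and [ga] terms cancel between opposite sides. The main terms left in [I1] and [I2]
       are opposite because both carry the same [be]: this is where closedness enters. *)
    assert (I1 : Rabs (RInt (fun t => P t c' - P t d') a' b' - - be * (d' - c') * (b' - a'))
      <= eta / 4 * s * (b' - a')).
    { apply RInt_near_const; [lra| |].
      - apply (ex_RInt_minus (fun t => P t c') (fun t => P t d')); apply HP; lra.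
      - intros t Ht.
        destruct (Hfar t c' Ht ltac:(lra)) as (F1 & F2 & F3).
        destruct (Hfar t d' Ht ltac:(lra)) as (G1 & G2 & G3).
        destruct (Hclose t c' F1 F2) as [E1 _]. destruct (Hclose t d' G1 G2) as [E2 _].
        assert (eta / 8 * (Rabs (t - x) + Rabs (c' - y)) <= eta / 8 * s) by nra.
        assert (eta / 8 * (Rabs (t - x) + Rabs (d' - y)) <= eta / 8 * s) by nra.
        apply Rabs_le_between in E1, E2. apply Rabs_le. lra. }
    assert (I2 : Rabs (RInt (fun t => Q b' t - Q a' t) c' d' - be * (b' - a') * (d' - c'))
      <= eta / 4 * s * (d' - c')).
    { apply RInt_near_const; [lra| |].
      - apply (ex_RInt_minus (fun t => Q b' t) (fun t => Q a' t)); apply HQ; lra.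
      - intros t Ht.
        destruct (Hfar b' t ltac:(lra) Ht) as (F1 & F2 & F3).
        destruct (Hfar a' t ltac:(lra) Ht) as (G1 & G2 & G3).
        destruct (Hclose b' t F1 F2) as [_ E1]. destruct (Hclose a' t G1 G2) as [_ E2].
        assert (eta / 8 * (Rabs (b' - x) + Rabs (t - y)) <= eta / 8 * s) by nra.
        assert (eta / 8 * (Rabs (a' - x) + Rabs (t - y)) <= eta / 8 * s) by nra.
        apply Rabs_le_between in E1, E2. apply Rabs_le. lra. }
    assert (Hs' : 0 < s) by (unfold s; lra).
    assert (Rabs (J a' b' c' d') <= eta / 4 * s ^ 2).
    { unfold J, boundary_integral. apply Rabs_le_between in I1, I2. apply Rabs_le.
      replace (eta / 4 * s ^ 2) with (eta / 4 * s * (b' - a') + eta / 4 * s * (d' - c'))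
        by (unfold s; field). lra. }
    assert (0 < eta * s ^ 2) by (apply Rmult_lt_0_compat; [lra|now apply pow_lt]).
    lra.
Qed.

(** * Mean values on circles *)

Lemma Cmod_Cexp (x y : R) : Cmod (Cexp (x, y)) = exp x.
Proof.
  unfold Cexp. simpl fst. simpl snd. unfold Cmod, Re, Im; simpl fst; simpl snd.
  replace ((exp x * cos y) ^ 2 + (exp x * sin y) ^ 2) with (exp x ^ 2 * ((sin y)² + (cos y)²))
    by (unfold Rsqr; ring).
  rewrite sin2_cos2, Rmult_1_r. apply sqrt_pow2. left; apply exp_pos.
Qed.

(** The form is the imaginary part of [G dz], and by Cauchy-Riemann both cross derivatives equal
    [Re D]. On vertical sides, where [dz = i dy], it reduces to [Re G dy], the integrand of the mean
    value. *)
Lemma holomorphic_closed_form (G : C -> C) (x y : R) (D : C) :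
  has_cderiv G (x, y) D ->
  closed_at (fun x y => Im (G (x, y))) (fun x y => Re (G (x, y))) x y.
Proof.
  intros H. rewrite has_cderiv_eps in H.
  exists (Im D), (Re D), (- Im D). intros eps Heps.
  destruct (H eps Heps) as (delta & Hd & Hw).
  exists (delta / 2). split; [lra|]. intros x' y' Hx Hy.
  pose proof (Cmod_le_Re_Im ((x', y') - (x, y))%C) as Hm. simpl in Hm.
  specialize (Hw (x', y')). assert (Hlt : Cmod ((x', y') - (x, y)) < delta).
  { eapply Rle_lt_trans; [exact Hm|]. unfold Rminus in Hx, Hy. lra. }
  specialize (Hw Hlt).
  pose proof (re_le_Cmod (G (x', y') - G (x, y) - D * ((x', y') - (x, y)))) as HR.
  pose proof (Im_le_Cmod (G (x', y') - G (x, y) - D * ((x', y') - (x, y)))) as HI.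
  assert (HE : eps * Cmod ((x', y') - (x, y)) <= eps * (Rabs (x' - x) + Rabs (y' - y)))
    by (apply Rmult_le_compat_l; [lra|exact Hm]).
  split.
  - eapply Rle_trans; [|exact HE]. eapply Rle_trans; [|exact Hw].
    eapply Rle_trans; [|exact HI]. right. f_equal. unfold Im, Re. simpl. ring.
  - eapply Rle_trans; [|exact HE]. eapply Rle_trans; [|exact Hw].
    eapply Rle_trans; [|exact HR]. right. f_equal. unfold Im, Re. simpl. ring.
Qed.

(* In the logarithmic coordinate [x + i y = log z] the circles become vertical segments,
   and by periodicity the horizontal sides of a rectangle of height [2 PI] cancel. *)
Lemma circle_mean (F : C -> C) :
  (forall z, 0 < Cmod z < 1 -> exists d, has_cderiv F z d) ->
  (forall eps, 0 < eps -> exists delta, 0 < delta /\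
     forall w, Cmod w < delta -> Cmod (F w - F 0) < eps) ->
  forall r, 0 < r < 1 ->
  is_RInt (fun t => Re (F (r * cos t, r * sin t))) 0 (2 * PI) (2 * PI * Re (F 0)).
Proof.
  intros HF H0 r Hr.
  pose proof PI_RGT_0 as HPI.
  set (P := fun x y => Im (F (Cexp (x, y)))).
  set (Q := fun x y => Re (F (Cexp (x, y)))).
  assert (Hclosed : forall x y, x < 0 -> closed_at P Q x y).
  { intros x y Hx. destruct (HF (Cexp (x, y))) as [d Hd].
    { rewrite Cmod_Cexp. split; [apply exp_pos|]. rewrite <- exp_0. now apply exp_increasing. }
    apply (holomorphic_closed_form (fun w => F (Cexp w)) x y (d * Cexp (x, y))%C).
    apply has_cderiv_comp; [exact Hd|apply Cexp_deriv]. }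
  set (b := ln r).
  assert (Hb : b < 0) by (unfold b; rewrite <- ln_1; apply ln_increasing; lra).
  assert (Hbr : exp b = r) by (unfold b; apply exp_ln; lra).
  assert (Hint : forall x, x < 0 -> ex_RInt (Q x) 0 (2 * PI)).
  { intros x Hx. destruct (ex_RInt_sides P Q x x 0 (2 * PI)) as [_ HQ].
    - intros s t Hs _. apply Hclosed; lra.
    - apply HQ; lra. }
  assert (Hconst : forall a, a < b -> RInt (Q a) 0 (2 * PI) = RInt (Q b) 0 (2 * PI)).
  { intros a Ha.
    assert (J0 : boundary_integral P Q a b 0 (2 * PI) = 0).
    { apply goursat_rectangle; [lra|lra|]. intros x y Hx _. apply Hclosed; lra. }
    unfold boundary_integral in J0.
    rewrite (RInt_ext (fun x => P x 0 - P x (2 * PI)) (fun _ => 0)) in J0.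
    2:{ intros x _. unfold P, Cexp. simpl.
        rewrite cos_0, sin_0, cos_2PI, sin_2PI. apply Rminus_diag. }
    rewrite RInt_const in J0.
    assert (E : RInt (fun y => Q b y - Q a y) 0 (2 * PI)
      = RInt (Q b) 0 (2 * PI) - RInt (Q a) 0 (2 * PI)).
    { apply (RInt_minus (Q b) (Q a)); apply Hint; lra. }
    rewrite E in J0. unfold scal in J0; simpl in J0. unfold mult in J0; simpl in J0. lra. }
  (* The integral does not depend on the radius, so it may be evaluated on a circle of radius
     [exp a <= delta/2], where continuity at 0 makes the integrand nearly constant. *)
  assert (Hval : RInt (Q b) 0 (2 * PI) = 2 * PI * Re (F 0)).
  { apply cond_eq. intros eps Heps.
    destruct (H0 (eps / (4 * PI))) as (delta & Hd & Hw).
    { apply Rdiv_lt_0_compat; lra. }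
    set (a := Rmin (b - 1) (ln (delta / 2))).
    assert (Hab : a < b) by (unfold a; pose proof (Rmin_l (b - 1) (ln (delta / 2))); lra).
    rewrite <- (Hconst a Hab).
    assert (N : Rabs (RInt (Q a) 0 (2 * PI) - Re (F 0) * (2 * PI - 0))
      <= eps / (4 * PI) * (2 * PI - 0)).
    { apply RInt_near_const; [lra|apply Hint; lra|].
      intros t _. unfold Q. left. eapply Rle_lt_trans; [|apply (Hw (Cexp (a, t)))].
      - replace (Re (F (Cexp (a, t))) - Re (F 0)) with (Re (F (Cexp (a, t)) - F 0)%C)
          by (unfold Re; simpl; ring). apply re_le_Cmod.
      - rewrite Cmod_Cexp. apply Rle_lt_trans with (exp (ln (delta / 2))).
        + destruct (Rmin_r (b - 1) (ln (delta / 2))) as [Hlt|Heq].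
          * left; apply exp_increasing; exact Hlt.
          * right; unfold a; now rewrite Heq.
        + rewrite exp_ln; lra. }
    replace (eps / (4 * PI) * (2 * PI - 0)) with (eps / 2) in N by (field; lra).
    replace (Re (F 0) * (2 * PI - 0)) with (2 * PI * Re (F 0)) in N by ring. lra. }
  rewrite <- Hval.
  apply (is_RInt_ext (Q b)).
  - intros t _. unfold Q, Cexp. simpl. now rewrite Hbr.
  - exact (RInt_correct (Q b) 0 (2 * PI) (Hint b Hb)).
Qed.

(* The mean of [w(z) (1 + t z)^2 / z^2] over a small circle is [c2 + 2 t c1]; the modulus
   of the integrand is at most [|1 + t z|^2 / |z|^2], whose mean tends to [1 + |t|^2].
   Taking [|t| = |c1|] with the right arguments gives [|c2| + 2 |c1|^2 <= 1 + |c1|^2]. *)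
Lemma is_RInt_trig (A B D : R) :
  is_RInt (fun x => A + B * cos x + D * sin x) 0 (2 * PI) (2 * PI * A).
Proof.
  replace (2 * PI * A) with
    ((A * (2 * PI) + B * sin (2 * PI) - D * cos (2 * PI)) - (A * 0 + B * sin 0 - D * cos 0)).
  - apply (is_RInt_derive (fun x => A * x + B * sin x - D * cos x)).
    + intros x _. auto_derive; auto; ring.
    + intros x _. apply (@ex_derive_continuous R_AbsRing R_NormedModule). auto_derive; auto.
  - rewrite cos_0, sin_0, cos_2PI, sin_2PI. ring.
Qed.

Lemma schwarz_second_coefficient (w : C -> C) (c1 c2 : C) :
  (forall z, inD z -> exists d, has_cderiv w z d) ->
  (forall z, inD z -> Cmod (w z) < 1) ->
  (exists K delta, 0 < delta /\ forall z, Cmod z < delta ->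
     Cmod (w z - c1 * z - c2 * z * z) <= K * Cmod z ^ 3) ->
  Cmod c2 <= 1 - Cmod c1 ^ 2.
Proof.
  intros Hd Hb (K & delta & Hdelta & HK).
  (* The rotation [lam] makes [c2] nonnegative, and the [t] chosen below makes [lam t c1 = |c1|^2].
     Both parts of the mean then add without cancellation, and integrating real parts suffices. *)
  assert (Hlam : exists lam : C, Cmod lam = 1 /\ (lam * c2)%C = RtoC (Cmod c2)).
  { destruct (Req_dec (Cmod c2) 0) as [E|E].
    - exists 1%C. rewrite Cmod_1, E. split; [reflexivity|]. rewrite (Cmod_eq_0 _ E). ring.
    - exists (Cconj c2 / Cmod c2)%C. split.
      + rewrite Cmod_div, Cmod_conj, Cmod_R, Rabs_pos_eq by
          (try apply Cmod_ge_0; now apply RtoC_neq_0). now field.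
      + replace (Cconj c2 / Cmod c2 * c2)%C with ((c2 * Cconj c2) / Cmod c2)%C
          by (field; now apply RtoC_neq_0).
        rewrite <- Cmod2_conj.
        replace (RtoC (Cmod c2 ^ 2)) with (Cmod c2 * Cmod c2)%C
          by (rewrite <- RtoC_mult; f_equal; ring).
        field. now apply RtoC_neq_0. }
  destruct Hlam as (lam & Hlam1 & Hlam2).
  assert (Hll : (lam * Cconj lam)%C = 1%C).
  { rewrite <- Cmod2_conj, Hlam1. now rewrite pow1. }
  set (t := (Cconj lam * Cconj c1)%C).
  assert (Ht : Cmod t = Cmod c1) by (unfold t; rewrite Cmod_mult, !Cmod_conj, Hlam1; ring).
  assert (Hlt : (lam * (t * c1))%C = RtoC (Cmod c1 ^ 2)).
  { rewrite Cmod2_conj. unfold t.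
    replace (lam * (Cconj lam * Cconj c1 * c1))%C with (lam * Cconj lam * (c1 * Cconj c1))%C by ring.
    rewrite Hll. ring. }
  (* The rotated integrand has the simple pole [lam c1 / z] at 0. Subtracting it makes the
     singularity removable, and the limit is put in as the value at 0; the pole itself has mean zero
     on circles. *)
  set (F := fun z : C => if excluded_middle_informative (z = 0%C)
    then (lam * (c2 + 2 * t * c1))%C
    else (lam * ((w z * ((1 + t * z) * (1 + t * z)) + - c1 * z) * (/ z * / z)))%C).
  assert (HF0 : F 0%C = RtoC (Cmod c2 + 2 * Cmod c1 ^ 2)).
  { unfold F. destruct excluded_middle_informative as [_|N]; [|now destruct N].
    replace (lam * (c2 + 2 * t * c1))%C with (lam * c2 + 2 * (lam * (t * c1)))%C by ring.
    rewrite Hlam2, Hlt. now rewrite RtoC_plus, RtoC_mult. }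
  assert (HFn : forall z : C, z <> 0%C ->
    F z = (lam * ((w z * ((1 + t * z) * (1 + t * z)) + - c1 * z) * (/ z * / z)))%C).
  { intros z Hz. unfold F. now destruct excluded_middle_informative. }
  assert (HFd : forall z, 0 < Cmod z < 1 -> exists d, has_cderiv F z d).
  { intros z Hz. assert (Hz0 : z <> 0%C) by (apply Cmod_gt_0; lra).
    destruct (Hd z ltac:(unfold inD; lra)) as [dw Hdw].
    eexists. eapply (has_cderiv_ext_near _ F z _ (Cmod z)); [lra| |].
    - intros u Hu. symmetry. apply HFn. intros ->.
      replace (0 - z)%C with (- z)%C in Hu by ring. rewrite Cmod_opp in Hu. lra.
    - apply has_cderiv_scal, has_cderiv_mult; [|apply has_cderiv_mult; apply has_cderiv_inv; exact Hz0].
      apply has_cderiv_plus; [|apply has_cderiv_scal, has_cderiv_id].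
      apply has_cderiv_mult; [exact Hdw|].
      apply has_cderiv_mult; (apply has_cderiv_plus;
        [apply has_cderiv_const|apply has_cderiv_scal, has_cderiv_id]). }
  assert (HFc : forall eps, 0 < eps -> exists delta, 0 < delta /\
     forall u, Cmod u < delta -> Cmod (F u - F 0%C) < eps).
  { set (T := Cmod t). assert (HT : 0 <= T) by apply Cmod_ge_0.
    (* For [|u| < 1] each of the three error terms isolated in [EF] is at most a constant times
       [|u|]; [M] is the sum of these constants. *)
    set (M := T * T * Cmod c1 + Cmod c2 * (2 * T + T * T) + Rabs K * ((1 + T) * (1 + T))).
    pose proof (Cmod_ge_0 c1). pose proof (Cmod_ge_0 c2). pose proof (Rabs_pos K).
    assert (HM : 0 <= M).
    { unfold M. repeat apply Rplus_le_le_0_compat; repeat apply Rmult_le_pos; nra. }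
    intros eps Heps. exists (Rmin delta (Rmin 1 (eps / (M + 1)))). split.
    { repeat apply Rmin_glb_lt; try lra. apply Rdiv_lt_0_compat; lra. }
    intros u Hu. apply Rmin_Rgt_l in Hu. destruct Hu as [Hu1 Hu].
    apply Rmin_Rgt_l in Hu. destruct Hu as [Hu2 Hu3].
    destruct (excluded_middle_informative (u = 0%C)) as [-> | Hu0].
    { replace (F 0 - F 0)%C with (RtoC 0) by ring. rewrite Cmod_0. exact Heps. }
    assert (Hup : 0 < Cmod u) by now apply Cmod_gt_0.
    set (e := (w u - c1 * u - c2 * u * u)%C).
    assert (He : Cmod e <= Rabs K * Cmod u ^ 3).
    { eapply Rle_trans; [apply HK; lra|]. apply Rmult_le_compat_r; [apply pow_le; lra|apply Rle_abs]. }
    assert (EF : (F u - F 0)%C = (lam * (t * t * c1 * u + c2 * u * (2 * t + t * t * u)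
        + e * ((1 + t * u) * (1 + t * u)) * (/ u * / u)))%C).
    { rewrite (HFn u Hu0). unfold F. destruct excluded_middle_informative as [_|N]; [|now destruct N].
      unfold e. field. exact Hu0. }
    rewrite EF, Cmod_mult, Hlam1, Rmult_1_l.
    assert (B1 : Cmod (t * t * c1 * u) = T * T * Cmod c1 * Cmod u) by now rewrite !Cmod_mult.
    assert (B2 : Cmod (c2 * u * (2 * t + t * t * u)) <= Cmod c2 * (2 * T + T * T) * Cmod u).
    { rewrite !Cmod_mult.
      assert (Cmod (2 * t + t * t * u) <= 2 * T + T * T).
      { eapply Rle_trans; [apply Cmod_triangle|]. rewrite !Cmod_mult, Cmod_R, Rabs_pos_eq by lra.
        fold T. nra. }
      replace (Cmod c2 * (2 * T + T * T) * Cmod u) with (Cmod c2 * Cmod u * (2 * T + T * T)) by ring.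
      apply Rmult_le_compat_l; [nra|assumption]. }
    assert (B3 : Cmod (e * ((1 + t * u) * (1 + t * u)) * (/ u * / u))
        <= Rabs K * ((1 + T) * (1 + T)) * Cmod u).
    { rewrite !Cmod_mult, Cmod_inv by exact Hu0.
      assert (HL : Cmod (1 + t * u) <= 1 + T).
      { eapply Rle_trans; [apply Cmod_triangle|]. rewrite Cmod_mult, Cmod_1. fold T. nra. }
      pose proof (Cmod_ge_0 (1 + t * u)).
      assert (HLL : Cmod (1 + t * u) * Cmod (1 + t * u) <= (1 + T) * (1 + T)) by nra.
      replace (Rabs K * ((1 + T) * (1 + T)) * Cmod u) with
        ((Rabs K * Cmod u ^ 3) * ((1 + T) * (1 + T)) * (/ Cmod u * / Cmod u)) by (field; lra).
      apply Rmult_le_compat_r.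
      { assert (0 < / Cmod u) by now apply Rinv_0_lt_compat. nra. }
      apply Rmult_le_compat; [apply Cmod_ge_0|nra|exact He|exact HLL]. }
    eapply Rle_lt_trans; [apply Cmod_triangle|].
    eapply Rle_lt_trans; [apply Rplus_le_compat; [apply Cmod_triangle|exact B3]|].
    rewrite B1.
    apply Rle_lt_trans with (M * Cmod u); [unfold M; lra|].
    apply (Rmult_lt_compat_r (M + 1)) in Hu3; [|lra].
    unfold Rdiv in Hu3. rewrite Rmult_assoc, Rinv_l in Hu3 by lra. nra. }
  (* Pointwise, [|w| < 1] bounds the real part by [|1 + t z|^2 / r^2] minus the pole. Its cosine and
     sine terms average to zero, leaving [1/r^2 + |c1|^2] against the mean [|c2| + 2 |c1|^2]. *)
  assert (Hmain : forall r, 0 < r < 1 -> Cmod c2 + Cmod c1 ^ 2 <= / r ^ 2).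
  { intros r Hr.
    pose proof (circle_mean F HFd HFc r Hr) as HI. rewrite HF0 in HI.
    destruct t as [t1 t2] eqn:Et. destruct (lam * c1)%C as [k1 k2] eqn:Ek.
    pose proof (is_RInt_trig ((1 + Cmod c1 ^ 2 * r ^ 2) / r ^ 2)
      (2 * t1 / r - k1 / r) (- 2 * t2 / r - k2 / r)) as HT.
    pose proof PI_RGT_0 as HPI.
    assert (HL : 2 * PI * Re (RtoC (Cmod c2 + 2 * Cmod c1 ^ 2))
      <= 2 * PI * ((1 + Cmod c1 ^ 2 * r ^ 2) / r ^ 2)).
    { refine (is_RInt_le _ _ _ _ _ _ _ HI HT _); [lra|].
      intros x _. set (z := (r * cos x, r * sin x) : C).
      pose proof (sin2_cos2 x) as Hsc. unfold Rsqr in Hsc.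
      assert (Hz : Cmod z = r).
      { unfold z, Cmod. simpl fst; simpl snd.
        replace ((r * cos x) ^ 2 + (r * sin x) ^ 2) with (r ^ 2 * (sin x * sin x + cos x * cos x)) by ring.
        rewrite Hsc, Rmult_1_r. apply sqrt_pow2; lra. }
      assert (Hz0 : z <> 0%C) by (apply Cmod_gt_0; lra).
      assert (Hiz : (/ z)%C = ((cos x / r)%R, (- sin x / r)%R)).
      { assert (E : (z * ((cos x / r)%R, (- sin x / r)%R))%C = 1%C).
        { unfold z, Cmult, RtoC; simpl. f_equal; [|field; lra].
          replace 1 with (sin x * sin x + cos x * cos x) by exact Hsc. field; lra. }
        transitivity (/ z * (z * ((cos x / r)%R, (- sin x / r)%R)))%C; [rewrite E; ring|field; exact Hz0]. }
      rewrite (HFn z Hz0).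
      replace (lam * ((w z * ((1 + (t1, t2) * z) * (1 + (t1, t2) * z)) + - c1 * z) * (/ z * / z)))%C
        with (lam * (w z * ((1 + (t1, t2) * z) * (1 + (t1, t2) * z)) * (/ z * / z)) - lam * c1 * / z)%C
        by (field; exact Hz0).
      rewrite Ek.
      assert (S1 : Rabs (Re (lam * (w z * ((1 + (t1, t2) * z) * (1 + (t1, t2) * z)) * (/ z * / z)))%C)
        <= Cmod (1 + (t1, t2) * z) ^ 2 / r ^ 2).
      { eapply Rle_trans; [apply re_le_Cmod|].
        rewrite !Cmod_mult, Cmod_inv, Hlam1, Hz by exact Hz0.
        pose proof (Hb z ltac:(unfold inD; lra)). pose proof (Cmod_ge_0 (w z)).
        pose proof (Cmod_ge_0 (1 + (t1, t2) * z)).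
        replace (Cmod (1 + (t1, t2) * z) ^ 2 / r ^ 2) with
          (1 * (1 * (Cmod (1 + (t1, t2) * z) * Cmod (1 + (t1, t2) * z)) * (/ r * / r))) by (field; lra).
        assert (0 < / r) by (apply Rinv_0_lt_compat; lra).
        rewrite !Rmult_1_l. apply Rmult_le_compat_r; [nra|]. nra. }
      apply Rabs_le_between in S1. rewrite Cmod2_alt in S1.
      assert (S2 : Re ((k1, k2) * / z)%C = k1 * (cos x / r) + k2 * (sin x / r)).
      { rewrite Hiz. unfold Re; simpl. field; lra. }
      assert (Ht2 : t1 ^ 2 + t2 ^ 2 = Cmod c1 ^ 2).
      { rewrite <- Ht, Cmod2_alt. reflexivity. }
      assert (S3 : (Re (1 + (t1, t2) * z)%C ^ 2 + Im (1 + (t1, t2) * z)%C ^ 2) / r ^ 2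
        = (1 + Cmod c1 ^ 2 * r ^ 2) / r ^ 2 + 2 * t1 / r * cos x - 2 * t2 / r * sin x).
      { rewrite <- Ht2. unfold z, Re, Im; simpl.
        transitivity ((1 + (t1 ^ 2 + t2 ^ 2) * r ^ 2 * (sin x * sin x + cos x * cos x)
          + 2 * r * (t1 * cos x - t2 * sin x)) / r ^ 2); [field; lra|].
        rewrite Hsc. field; lra. }
      match goal with |- Re (?a - ?b)%C <= _ =>
        replace (Re (a - b)%C) with (Re a - Re b) by (unfold Re; simpl; ring) end.
      rewrite S2. unfold Rdiv in *. lra. }
    apply Rmult_le_reg_l in HL; [|lra]. simpl Re in HL. unfold Re in HL; simpl fst in HL.
    replace ((1 + Cmod c1 ^ 2 * r ^ 2) / r ^ 2) with (/ r ^ 2 + Cmod c1 ^ 2) in HL by (field; lra).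
    lra. }
  (* This is the limit [r -> 1]: if [q > 1], the arithmetic-geometric mean inequality gives
     [r^2 > 1/q] for [r = (1 + 1/q)/2], contradicting [Hmain]. *)
  set (q := Cmod c2 + Cmod c1 ^ 2) in *.
  destruct (Rle_dec q 1) as [Hq|Hq]; [unfold q in Hq; lra|exfalso].
  assert (Hq1 : 0 < / q < 1).
  { split; [apply Rinv_0_lt_compat; lra|]. rewrite <- Rinv_1. apply Rinv_lt_contravar; lra. }
  specialize (Hmain ((1 + / q) / 2) ltac:(lra)).
  assert (Hr : / q < ((1 + / q) / 2) ^ 2) by nra.
  apply Rinv_lt_contravar in Hr; [|nra]. rewrite Rinv_inv in Hr. lra.
Qed.

(** * Complex series and local expansions *)

Lemma Cmod_minus_sym (z w : C) : Cmod (z - w) = Cmod (w - z).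
Proof. rewrite <- Cmod_opp. f_equal. ring. Qed.

Definition is_Cseries (a : nat -> C) (l : C) : Prop :=
  @is_series C_AbsRing C_NormedModule a l.

Lemma sum_n_Re_Im (a : nat -> C) (n : nat) :
  @sum_n C_NormedModule a n =
  (sum_n (fun k => Re (a k)) n, sum_n (fun k => Im (a k)) n) :> C.
Proof.
  induction n as [|n IH].
  - rewrite !sum_O. now destruct (a 0%nat).
  - rewrite !sum_Sn, IH. destruct (a (S n)). reflexivity.
Qed.

Lemma is_Cseries_iff (a : nat -> C) (l : C) :
  is_Cseries a l <->
  is_series (fun n => Re (a n)) (Re l) /\ is_series (fun n => Im (a n)) (Im l).
Proof.
  split.
  - intros H. split; apply filterlim_locally; intros eps;
      pose proof (proj1 (filterlim_locally _ _) H eps) as [N HN];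
      exists N; intros n Hn; specialize (HN n Hn);
      rewrite sum_n_Re_Im in HN; apply HN.
  - intros [H1 H2]. apply filterlim_locally. intros eps.
    pose proof (proj1 (filterlim_locally _ _) H1 eps) as [N1 HN1].
    pose proof (proj1 (filterlim_locally _ _) H2 eps) as [N2 HN2].
    exists (max N1 N2). intros n Hn. rewrite sum_n_Re_Im.
    split; simpl; [apply HN1; lia|apply HN2; lia].
Qed.

Lemma is_Cseries_unique (a : nat -> C) (l l' : C) :
  is_Cseries a l -> is_Cseries a l' -> l = l'.
Proof.
  rewrite !is_Cseries_iff. intros [H1 H2] [H3 H4].
  destruct l as [x y], l' as [x' y']. simpl in *.
  f_equal; [rewrite <- (is_series_unique _ _ H1)|rewrite <- (is_series_unique _ _ H2)];
    now apply is_series_unique.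
Qed.

Lemma is_Cseries_le (b : nat -> C) (c : nat -> R) (l : C) (s : R) :
  is_Cseries b l -> is_series c s -> (forall n, Cmod (b n) <= c n) -> Cmod l <= s.
Proof.
  intros Hb Hc Hle. apply le_epsilon. intros eps Heps.
  destruct (proj1 (is_Cseries_iff b l) Hb) as [H1 H2].
  destruct (proj1 (filterlim_locally _ _) H1 (mkposreal (eps / 2) ltac:(lra))) as [N1 HN1].
  destruct (proj1 (filterlim_locally _ _) H2 (mkposreal (eps / 2) ltac:(lra))) as [N2 HN2].
  set (n := max N1 N2). specialize (HN1 n ltac:(lia)). specialize (HN2 n ltac:(lia)).
  pose (S := @sum_n C_NormedModule b n).
  assert (HS : Cmod (S - l) <= eps).
  { eapply Rle_trans; [apply Cmod_le_Re_Im|]. unfold S. rewrite sum_n_Re_Im.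
    assert (B1 : Rabs (sum_n (fun k => Re (b k)) n + - Re l) < eps / 2) by exact HN1.
    assert (B2 : Rabs (sum_n (fun k => Im (b k)) n + - Im l) < eps / 2) by exact HN2.
    left. replace eps with (eps / 2 + eps / 2) by field.
    exact (Rplus_lt_compat _ _ _ _ B1 B2). }
  assert (HSc : Cmod S <= sum_n c n).
  { unfold S. clear -Hle. induction n as [|n IH].
    - rewrite !sum_O. apply Hle.
    - rewrite !sum_Sn. eapply Rle_trans; [apply Cmod_triangle|].
      apply Rplus_le_compat; [exact IH|apply Hle]. }
  assert (Hcs : sum_n c n <= s).
  { apply is_lim_seq_incr_compare; [exact Hc|]. intros k. rewrite sum_Sn.
    pose proof (Hle (Datatypes.S k)). pose proof (Cmod_ge_0 (b (Datatypes.S k))).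
    unfold plus; simpl. lra. }
  pose proof (Cmod_triangle S (l - S)) as T. replace (S + (l - S))%C with l in T by ring.
  rewrite (Cmod_minus_sym l S) in T. lra.
Qed.

Lemma is_Cseries_terms_bounded (a : nat -> C) (l : C) :
  is_Cseries a l -> exists M, 0 <= M /\ forall n, Cmod (a n) <= M.
Proof.
  rewrite is_Cseries_iff. intros [H1 H2].
  destruct (@filterlim_bounded R_AbsRing R_NormedModule (fun n => Re (a n))) as [M1 HM1].
  { exists 0. exact (ex_series_lim_0 _ (ex_intro _ _ H1)). }
  destruct (@filterlim_bounded R_AbsRing R_NormedModule (fun n => Im (a n))) as [M2 HM2].
  { exists 0. exact (ex_series_lim_0 _ (ex_intro _ _ H2)). }
  assert (H : forall n, Cmod (a n) <= M1 + M2).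
  { intros n. eapply Rle_trans; [apply Cmod_le_Re_Im|].
    apply Rplus_le_compat; [apply HM1|apply HM2]. }
  exists (M1 + M2). split; [|exact H]. eapply Rle_trans; [apply Cmod_ge_0|apply (H 0%nat)].
Qed.

Lemma Cpow_diff_bound (z w : C) (r : R) (n : nat) :
  Cmod z <= r -> Cmod w <= r ->
  Cmod (z ^ S n - w ^ S n) <= INR (S n) * r ^ n * Cmod (z - w).
Proof.
  intros Hz Hw. induction n as [|n IH].
  - simpl. rewrite !Cmult_1_r. lra.
  - replace (z ^ S (S n) - w ^ S (S n))%C
      with (z * (z ^ S n - w ^ S n) + (z - w) * w ^ S n)%C
      by (change (z ^ S (S n))%C with (z * z ^ S n)%C;
          change (w ^ S (S n))%C with (w * w ^ S n)%C; ring).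
    eapply Rle_trans; [apply Cmod_triangle|]. rewrite !Cmod_mult, Cmod_pow.
    rewrite (S_INR (S n)). pose proof (Cmod_ge_0 z). pose proof (Cmod_ge_0 w).
    assert (Hp : Cmod w ^ S n <= r ^ S n) by (apply pow_incr; lra).
    assert (0 <= r ^ n) by (apply pow_le; lra).
    pose proof (Cmod_ge_0 (z - w)).
    replace ((INR (S n) + 1) * r ^ S n * Cmod (z - w)) with
      (r * (INR (S n) * r ^ n * Cmod (z - w)) + Cmod (z - w) * r ^ S n) by (simpl; ring).
    apply Rplus_le_compat.
    + apply Rmult_le_compat; auto. apply Cmod_ge_0.
    + now apply Rmult_le_compat_l.
Qed.

Lemma has_cderiv_lipschitz (g : C -> C) (z d : C) (L delta : R) :
  has_cderiv g z d -> 0 < delta ->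
  (forall w, Cmod (w - z) < delta -> Cmod (g w - g z) <= L * Cmod (w - z)) ->
  Cmod d <= L.
Proof.
  intros Hg Hd HL. apply le_epsilon. intros eps Heps.
  rewrite has_cderiv_eps in Hg. destruct (Hg eps Heps) as (delta' & Hd' & Hw).
  set (h := Rmin delta delta' / 2).
  assert (Hh : 0 < h < delta /\ h < delta').
  { unfold h. pose proof (Rmin_l delta delta'). pose proof (Rmin_r delta delta').
    assert (0 < Rmin delta delta') by now apply Rmin_glb_lt. lra. }
  assert (Hm : Cmod (z + h - z) = h).
  { replace (z + h - z)%C with (RtoC h) by ring. rewrite Cmod_R. apply Rabs_pos_eq; lra. }
  specialize (HL (z + h)%C). specialize (Hw (z + h)%C). rewrite Hm in HL, Hw.
  specialize (HL ltac:(lra)). specialize (Hw ltac:(lra)).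
  replace (z + h - z)%C with (RtoC h) in Hw by ring.
  pose proof (Cmod_triangle (g (z + h)%C - g z) (- (g (z + h)%C - g z - d * h))) as T.
  replace (g (z + h)%C - g z + - (g (z + h)%C - g z - d * h))%C with (d * h)%C in T by ring.
  rewrite Cmod_opp, Cmod_mult, Cmod_R, (Rabs_pos_eq h) in T by lra.
  apply Rmult_le_reg_r with h; lra.
Qed.

(** Requiring [delta <= 1] keeps the neighbourhood inside the unit disk and lets the exponent be
    lowered with the same [K]. *)
Definition bigO (g : C -> C) (n : nat) : Prop :=
  exists K delta, 0 < delta <= 1 /\ 0 <= K /\
    forall z, Cmod z < delta -> Cmod (g z) <= K * Cmod z ^ n.

Lemma bigO_ext (f g : C -> C) (n : nat) :
  (forall z, inD z -> f z = g z) -> bigO f n -> bigO g n.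
Proof.
  intros E (K & d & Hd & HK & H). exists K, d. repeat split; try lra.
  intros z Hz. rewrite <- E by (unfold inD; lra). now apply H.
Qed.

Lemma bigO_plus (f g : C -> C) (n : nat) :
  bigO f n -> bigO g n -> bigO (fun z => f z + g z)%C n.
Proof.
  intros (K & d & Hd & HK & H) (K' & d' & Hd' & HK' & H').
  exists (K + K'), (Rmin d d').
  pose proof (Rmin_l d d'). pose proof (Rmin_r d d').
  split; [split; [apply Rmin_glb_lt; lra|lra]|]. split; [lra|].
  intros z Hz. specialize (H z ltac:(lra)). specialize (H' z ltac:(lra)).
  eapply Rle_trans; [apply Cmod_triangle|]. lra.
Qed.

Lemma bigO_mult (f g : C -> C) (n m : nat) :
  bigO f n -> bigO g m -> bigO (fun z => f z * g z)%C (n + m).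
Proof.
  intros (K & d & Hd & HK & H) (K' & d' & Hd' & HK' & H').
  exists (K * K'), (Rmin d d').
  pose proof (Rmin_l d d'). pose proof (Rmin_r d d').
  split; [split; [apply Rmin_glb_lt; lra|lra]|]. split; [nra|].
  intros z Hz. specialize (H z ltac:(lra)). specialize (H' z ltac:(lra)).
  rewrite Cmod_mult, pow_add.
  replace (K * K' * (Cmod z ^ n * Cmod z ^ m)) with (K * Cmod z ^ n * (K' * Cmod z ^ m)) by ring.
  apply Rmult_le_compat; auto; apply Cmod_ge_0.
Qed.

Lemma bigO_weaken (f : C -> C) (n m : nat) : (m <= n)%nat -> bigO f n -> bigO f m.
Proof.
  intros Hnm (K & d & Hd & HK & H). exists K, d. repeat split; try lra.
  intros z Hz. eapply Rle_trans; [now apply H|]. apply Rmult_le_compat_l; [lra|].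
  replace n with (m + (n - m))%nat by lia. rewrite pow_add.
  pose proof (Cmod_ge_0 z). assert (0 <= Cmod z ^ m) by now apply pow_le.
  assert (Cmod z ^ (n - m) <= 1 ^ (n - m)) by (apply pow_incr; lra). rewrite pow1 in *. nra.
Qed.

Lemma bigO_const (c : C) : bigO (fun _ => c) 0.
Proof.
  exists (Cmod c), 1. split; [lra|]. split; [apply Cmod_ge_0|]. intros z _. simpl; lra.
Qed.

Lemma bigO_id : bigO (fun z => z) 1.
Proof. exists 1, 1. repeat split; try lra. intros z _. simpl; lra. Qed.

Lemma bigO_scal (c : C) (f : C -> C) (n : nat) : bigO f n -> bigO (fun z => c * f z)%C n.
Proof. intros H. exact (bigO_mult _ _ 0 n (bigO_const c) H). Qed.

Lemma bigO_pow (c : C) (n : nat) : bigO (fun z => c * z ^ n)%C n.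
Proof.
  apply bigO_scal. induction n as [|n IH].
  - apply (bigO_ext (fun _ => 1%C)); [reflexivity|]. apply bigO_const.
  - exact (bigO_mult _ _ 1 n bigO_id IH).
Qed.

(** The estimate is on differences because a Lipschitz constant of the remainder also bounds its
    derivative; [w = 0] recovers the values. Convergence at [1/2] supplies [|a n| <= M 2^n]. *)
Lemma power_series_remainder (a : nat -> C) (f : C -> C) :
  (forall z, inD z -> is_Cseries (fun n => a n * z ^ n)%C (f z)) ->
  exists K, 0 <= K /\ forall z w r, r <= 1 / 8 -> Cmod z <= r -> Cmod w <= r ->
    Cmod ((f z - (a 0%nat + a 1%nat * z + a 2%nat * z ^ 2 + a 3%nat * z ^ 3))
      - (f w - (a 0%nat + a 1%nat * w + a 2%nat * w ^ 2 + a 3%nat * w ^ 3)))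
    <= K * r ^ 3 * Cmod (z - w).
Proof.
  intros Hf.
  assert (Hhalf : inD (RtoC (/ 2))) by (unfold inD; rewrite Cmod_R, Rabs_pos_eq; lra).
  destruct (is_Cseries_terms_bounded _ _ (Hf _ Hhalf)) as (M & HM & Hb).
  assert (Hcoef : forall n, Cmod (a n) <= M * 2 ^ n).
  { intros n. specialize (Hb n). rewrite Cmod_mult, Cmod_pow, Cmod_R, Rabs_pos_eq in Hb by lra.
    assert (0 < 2 ^ n) by (apply pow_lt; lra).
    replace (Cmod (a n)) with (Cmod (a n) * (/ 2) ^ n * 2 ^ n).
    - apply Rmult_le_compat_r; lra.
    - rewrite pow_inv. field. lra. }
  (* With [n <= 2^n], the tail is dominated by a geometric series of ratio [4 r <= 1/2]. Its leading
     term carries [2^4 * 2^4 = 256], and summation at most doubles it. *)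
  exists (512 * M). split; [lra|]. intros z w r Hr Hz Hw.
  pose proof (Cmod_ge_0 z) as Hz0.
  assert (Htail : forall u, Cmod u <= r -> is_Cseries (fun n => a (4 + n)%nat * u ^ (4 + n))%C
    (f u - (a 0%nat + a 1%nat * u + a 2%nat * u ^ 2 + a 3%nat * u ^ 3))%C).
  { intros u Hu.
    assert (E : plus (f u - (a 0%nat + a 1%nat * u + a 2%nat * u ^ 2 + a 3%nat * u ^ 3))%C
      (@sum_n C_NormedModule (fun n => a n * u ^ n)%C (pred 4)) = f u).
    { simpl pred. rewrite !sum_Sn, sum_O. unfold plus; simpl. ring. }
    pose proof (Hf u ltac:(unfold inD; lra)) as H. rewrite <- E in H.
    exact (is_series_incr_n (fun n => a n * u ^ n)%C 4 _ (Nat.lt_0_succ 3) H). }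
  assert (Hgeom : is_series (fun n => Cmod (z - w) * M * 256 * r ^ 3 * (4 * r) ^ n)
     (Cmod (z - w) * M * 256 * r ^ 3 * / (1 - 4 * r))).
  { apply (is_series_scal (Cmod (z - w) * M * 256 * r ^ 3) (fun n => (4 * r) ^ n)).
    apply is_series_geom. rewrite Rabs_pos_eq; lra. }
  eapply Rle_trans.
  - eapply is_Cseries_le; [|exact Hgeom|].
    + apply (is_series_minus _ _ _ _ (Htail z Hz) (Htail w Hw)).
    + intros n.
      assert (E : (a (4 + n)%nat * z ^ (4 + n) - a (4 + n)%nat * w ^ (4 + n)
        = a (4 + n)%nat * (z ^ S (3 + n) - w ^ S (3 + n)))%C)
        by (change (4 + n)%nat with (S (3 + n)); ring).
      change (Cmod (a (4 + n)%nat * z ^ (4 + n) - a (4 + n)%nat * w ^ (4 + n))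
        <= Cmod (z - w) * M * 256 * r ^ 3 * (4 * r) ^ n).
      rewrite E, Cmod_mult.
      apply Rle_trans with (M * 2 ^ (4 + n) * (2 ^ (4 + n) * r ^ (3 + n) * Cmod (z - w))).
      * apply Rmult_le_compat; try apply Cmod_ge_0; [apply Hcoef|].
        eapply Rle_trans; [apply (Cpow_diff_bound z w r _ Hz Hw)|].
        apply Rmult_le_compat_r; [apply Cmod_ge_0|].
        apply Rmult_le_compat_r; [apply pow_le; lra|].
        clear. change (S (3 + n)) with (4 + n)%nat.
        generalize (4 + n)%nat. intros k. induction k as [|k IH]; [simpl; lra|].
        rewrite S_INR. simpl. assert (1 <= 2 ^ k) by (apply pow_R1_Rle; lra). lra.
      * right. replace ((4 * r) ^ n) with (2 ^ n * 2 ^ n * r ^ n)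
          by (rewrite <- !Rpow_mult_distr; f_equal; ring).
        rewrite !pow_add. simpl. ring.
  - assert (/ (1 - 4 * r) <= 2).
    { rewrite <- (Rinv_inv 2). apply Rinv_le_contravar; lra. }
    assert (0 <= Cmod (z - w) * M * 256 * r ^ 3).
    { pose proof (Cmod_ge_0 (z - w)). assert (0 <= r ^ 3) by (apply pow_le; lra).
      repeat apply Rmult_le_pos; lra. }
    nra.
Qed.

(** Near 0 one has [|f z| >= |z|/2], so cancelling [f] costs one order. At [z = 0] cancellation
    gives no information, and [g 0 = 0] takes over. *)
Lemma bigO_div_near_id (g f : C -> C) (n : nat) :
  bigO (fun z => f z - z)%C 2 -> g 0%C = 0%C ->
  bigO (fun z => g z * f z)%C (S n) -> bigO g n.
Proof.
  intros (K & d & Hd & HK & H) Hg0 (K' & d' & Hd' & HK' & H').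
  exists (2 * K'), (Rmin (Rmin d d') (/ (2 * (K + 1)))).
  assert (Hpos : 0 < / (2 * (K + 1))) by (apply Rinv_0_lt_compat; lra).
  split; [split; [repeat apply Rmin_glb_lt; lra|]|].
  { eapply Rle_trans; [apply Rmin_l|]. eapply Rle_trans; [apply Rmin_l|]. lra. }
  split; [lra|]. intros z Hz.
  apply Rmin_Rgt_l in Hz. destruct Hz as [Hz1 Hz3].
  apply Rmin_Rgt_l in Hz1. destruct Hz1 as [Hz1 Hz2].
  specialize (H z ltac:(lra)). specialize (H' z ltac:(lra)).
  destruct (Req_dec (Cmod z) 0) as [E|E].
  { rewrite (Cmod_eq_0 _ E), Hg0, Cmod_0. apply Rmult_le_pos; [lra|apply pow_le; lra]. }
  pose proof (Cmod_ge_0 z) as Hz0.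
  assert (Hf : Cmod z / 2 <= Cmod (f z)).
  { pose proof (Cmod_triangle (f z) (z - f z)) as T.
    replace (f z + (z - f z))%C with z in T by ring. rewrite (Cmod_minus_sym z) in T.
    assert (Cmod z * (2 * (K + 1)) < 1).
    { apply (Rmult_lt_compat_r (2 * (K + 1))) in Hz3; [|lra]. rewrite Rinv_l in Hz3; lra. }
    simpl in H. nra. }
  rewrite Cmod_mult in H'.
  assert (HS : Cmod (g z) * (Cmod z / 2) <= K' * Cmod z ^ S n).
  { eapply Rle_trans; [|exact H']. apply Rmult_le_compat_l; [apply Cmod_ge_0|exact Hf]. }
  apply Rmult_le_reg_r with (Cmod z / 2); [lra|].
  eapply Rle_trans; [exact HS|]. right. simpl. field.
Qed.

(* [f'] is expanded through a local Lipschitz constant of the Taylor remainder of [f]. *)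
Lemma log_derivative_expansion (a : nat -> C) (f p : C -> C) :
  in_A a f -> is_zf'_over_f f p ->
  bigO (fun z => p z - (1 + a 2%nat * z + (2 * a 3%nat - a 2%nat ^ 2) * z ^ 2))%C 3.
Proof.
  intros (Ha0 & Ha1 & Hf) (Hp0 & Hp).
  destruct (power_series_remainder a f Hf) as (K & HK & HR).
  rewrite Ha0, Ha1 in HR.
  set (R := fun z : C => (f z - (0 + 1 * z + a 2%nat * z ^ 2 + a 3%nat * z ^ 3))%C).
  assert (Hf0 : f 0%C = 0%C).
  { apply Cmod_eq_0. apply Rle_antisym; [|apply Cmod_ge_0].
    assert (Hg : Rabs (/ 2) < 1) by (rewrite Rabs_pos_eq; lra).
    apply Rle_trans with (0 * / (1 - / 2)); [|right; apply Rmult_0_l].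
    apply (is_Cseries_le (fun n => a n * 0 ^ n)%C (fun n => 0 * (/ 2) ^ n)).
    - apply Hf. unfold inD. rewrite Cmod_0. lra.
    - exact (is_series_scal 0 _ _ (is_series_geom _ Hg)).
    - intros [|n]; rewrite Rmult_0_l; simpl.
      + rewrite Ha0, Cmult_0_l, Cmod_0. lra.
      + rewrite Cmult_0_l, Cmult_0_r, Cmod_0. lra. }
  assert (HO4 : bigO R 4).
  { exists K, (1 / 8). repeat split; try lra. intros z Hz.
    pose proof (Cmod_ge_0 z).
    specialize (HR z 0%C (Cmod z) ltac:(lra) ltac:(lra) ltac:(rewrite Cmod_0; lra)).
    rewrite Hf0 in HR. unfold R.
    match type of HR with Cmod ?A <= _ => replace A with (R z) in HR by (unfold R; simpl; ring) end.
    replace (z - 0)%C with z in HR by ring. fold (R z). simpl in *. lra. }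
  assert (HO1 : bigO (fun z => f z - z)%C 2).
  { apply (bigO_ext (fun z => R z + (a 2%nat * z ^ 2 + a 3%nat * z ^ 3))%C).
    - intros z _. unfold R. ring.
    - apply bigO_plus; [apply (bigO_weaken _ 4); [lia|exact HO4]|].
      apply bigO_plus; [apply bigO_pow|apply (bigO_weaken _ 3); [lia|apply bigO_pow]]. }
  assert (HOd : bigO (fun z => p z * f z - z * (1 + 2 * a 2%nat * z + 3 * a 3%nat * z ^ 2))%C 4).
  { exists (8 * K), (1 / 16). repeat split; try lra. intros z Hz.
    destruct (Req_dec (Cmod z) 0) as [E|E].
    { rewrite (Cmod_eq_0 _ E), Hf0, Cmod_0.
      replace (_ - _)%C with (RtoC 0) by (simpl; ring). rewrite Cmod_0. simpl; lra. }
    pose proof (Cmod_ge_0 z).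
    assert (Hz0 : z <> 0%C) by (apply Cmod_gt_0; lra).
    destruct (Hp z ltac:(unfold inD; lra) Hz0) as (Hfz & d & Hd & <-).
    replace (z * d / f z * f z - z * (1 + 2 * a 2%nat * z + 3 * a 3%nat * z ^ 2))%C
      with (z * (d - (1 + 2 * a 2%nat * z + 3 * a 3%nat * z ^ 2)))%C by (field; exact Hfz).
    rewrite Cmod_mult.
    replace (8 * K * Cmod z ^ 4) with (Cmod z * (K * (2 * Cmod z) ^ 3)) by (simpl; ring).
    apply Rmult_le_compat_l; [lra|].
    (* Points within [|z|] of [z] have modulus at most [2 |z|], which the radius [1/16] keeps below
       [1/8]. Hence [|R'(z)| <= K (2 |z|)^3]. *)
    apply (has_cderiv_lipschitz R z _ _ (Cmod z)); [|lra|].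
    - apply (has_cderiv_ext_near (fun u => f u + - (1) * (u
          + (a 2%nat * (u * u) + a 3%nat * (u * (u * u)))))%C R z _ 1 Rlt_0_1).
      { intros u _. unfold R. simpl. ring. }
      pose proof (has_cderiv_id z) as D1.
      pose proof (has_cderiv_mult _ _ z _ _ D1 D1) as D2.
      pose proof (has_cderiv_mult _ _ z _ _ D1 D2) as D3.
      pose proof (has_cderiv_plus _ _ z _ _ D1 (has_cderiv_plus _ _ z _ _
        (has_cderiv_scal (a 2%nat) _ z _ D2) (has_cderiv_scal (a 3%nat) _ z _ D3))) as D4.
      refine (has_cderiv_val _ z _ _ _
        (has_cderiv_plus _ _ z _ _ Hd (has_cderiv_scal (- (1))%C _ z _ D4))).
      ring.
    - intros w Hw. apply HR; [lra| |lra].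
      pose proof (Cmod_triangle (w - z) z) as T. replace (w - z + z)%C with w in T by ring. lra. }
  apply (bigO_div_near_id _ f _ HO1).
  { rewrite Hp0. ring. }
  (* The quadratic claimed for [p], times the cubic Taylor polynomial of [f], agrees with that of
     [z f'] through [z^3]. The overshoot is the explicit [z^4] and [z^5] terms. *)
  apply (bigO_ext (fun z => (p z * f z - z * (1 + 2 * a 2%nat * z + 3 * a 3%nat * z ^ 2))
    + (- (1) * ((1 + a 2%nat * z ^ 1 + (2 * a 3%nat - a 2%nat ^ 2) * z ^ 2) * R z)
     + (- (a 2%nat * a 3%nat + (2 * a 3%nat - a 2%nat ^ 2) * a 2%nat) * z ^ 4
        + - ((2 * a 3%nat - a 2%nat ^ 2) * a 3%nat) * z ^ 5)))%C).
  { intros z _. unfold R. ring. }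
  apply bigO_plus; [exact HOd|]. apply bigO_plus; [|apply bigO_plus].
  - apply bigO_scal. apply (bigO_mult _ _ 0 4); [|exact HO4].
    apply bigO_plus; [apply bigO_plus|].
    + apply bigO_const.
    + apply (bigO_weaken _ 1); [lia|apply bigO_pow].
    + apply (bigO_weaken _ 2); [lia|apply bigO_pow].
  - apply bigO_pow.
  - apply (bigO_weaken _ 5); [lia|apply bigO_pow].
Qed.

(** * The bounds *)

Lemma bigO_hch (w : C -> C) :
  bigO w 1 -> (forall z, inD z -> Cmod (w z) < 1) ->
  bigO (fun z => hch (w z) - 1 - w z - w z * w z / 2)%C 3.
Proof.
  intros (K & d & Hd & HK & H) Hw. exists (20 * K ^ 3), d.
  split; [exact Hd|]. split; [apply Rmult_le_pos; [lra|now apply pow_le]|].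
  intros z Hz. specialize (H z Hz).
  eapply Rle_trans; [apply hch_taylor2; left; apply Hw; unfold inD; lra|].
  rewrite Rmult_assoc, <- Rpow_mult_distr. apply Rmult_le_compat_l; [lra|].
  apply pow_incr. split; [apply Cmod_ge_0|]. simpl in H. lra.
Qed.

Lemma bigO_derivable (w : C -> C) (d : C) : w 0%C = 0%C -> has_cderiv w 0 d -> bigO w 1.
Proof.
  intros Hw0 Hd. rewrite has_cderiv_eps in Hd. destruct (Hd 1 Rlt_0_1) as (e & He & H).
  pose proof (Cmod_ge_0 d).
  exists (1 + Cmod d), (Rmin e 1).
  split; [split; [apply Rmin_glb_lt; lra|apply Rmin_r]|]. split; [lra|].
  intros z Hz. pose proof (Rmin_l e 1).
  specialize (H z). rewrite Hw0 in H. replace (z - 0)%C with z in H by ring.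
  specialize (H ltac:(lra)).
  pose proof (Cmod_triangle (w z - 0 - d * z) (d * z)) as T.
  replace (w z - 0 - d * z + d * z)%C with (w z) in T by ring.
  rewrite Cmod_mult in T. simpl. lra.
Qed.

(** The relation [w + w^2/2 = a2 z + B z^2 + O(z^3)] is inverted by bootstrapping. From [w = O(z)]
    follows [w = a2 z + O(z^2)]; then [w^2 - (a2 z)^2 = (w - a2 z)(w + a2 z) = O(z^3)], which gives
    the second coefficient [B - a2^2/2]. *)
Lemma schwarz_function_expansion (a : nat -> C) (f p w : C -> C) :
  in_A a f -> is_zf'_over_f f p ->
  w 0%C = 0%C -> (exists d, has_cderiv w 0 d) ->
  (forall z, inD z -> Cmod (w z) < 1) ->
  (forall z, inD z -> p z = hch (w z)) ->
  bigO (fun z => w z - a 2%nat * z - (2 * a 3%nat - 3 / 2 * a 2%nat ^ 2) * z * z)%C 3.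
Proof.
  intros HA Hp Hw0 [d Hd] Hw Hpw.
  pose proof (log_derivative_expansion a f p HA Hp) as HP.
  pose proof (bigO_derivable w d Hw0 Hd) as W1.
  pose proof (bigO_hch w W1 Hw) as HH.
  set (B := (2 * a 3%nat - a 2%nat ^ 2)%C) in *.
  assert (HE : bigO (fun z => w z + w z * w z / 2 - (a 2%nat * z ^ 1 + B * z ^ 2))%C 3).
  { eapply bigO_ext; [|apply (bigO_plus _ _ _ HP (bigO_scal (- (1))%C _ _ HH))].
    intros z Hz. simpl. rewrite (Hpw z Hz). field. }
  assert (W2 : bigO (fun z => w z - a 2%nat * z ^ 1)%C 2).
  { eapply bigO_ext; [|apply bigO_plus; [apply (bigO_weaken _ 3 2); [lia|exact HE]|
      apply bigO_plus; [apply (bigO_scal (- / 2)%C _ _ (bigO_mult _ _ 1 1 W1 W1))|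
        apply (bigO_pow B 2)]]].
    intros z Hz. simpl. field. }
  eapply bigO_ext; [|apply bigO_plus; [exact HE|apply (bigO_scal (- / 2)%C);
     apply (bigO_mult _ _ 2 1 W2 (bigO_plus _ _ _ W1 (bigO_pow (a 2%nat) 1)))]].
  intros z Hz. unfold B. simpl. field.
Qed.

Lemma gamma2_eq (a : nat -> C) :
  gamma2 a = (((2 * a 3%nat - 3 / 2 * a 2%nat ^ 2) + a 2%nat * a 2%nat / 2) / 4)%C.
Proof. unfold gamma2. simpl. field. Qed.

Lemma sqrt6_bounds : (1 / sqrt 6) ^ 2 = 1 / 6 /\ 1 / 3 < 1 / sqrt 6.
Proof.
  assert (H6 : sqrt 6 * sqrt 6 = 6) by (apply sqrt_sqrt; lra).
  assert (H0 : 0 < sqrt 6) by (apply sqrt_lt_R0; lra).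
  split.
  - unfold Rdiv. rewrite Rpow_mult_distr, pow1, pow_inv. simpl. rewrite Rmult_1_r, H6. field.
  - apply Rmult_lt_reg_r with (sqrt 6); [exact H0|].
    unfold Rdiv. rewrite (Rmult_assoc 1 (/ sqrt 6)), Rinv_l by lra. nra.
Qed.

Lemma Sch_gamma_bounds (a : nat -> C) (f : C -> C) :
  in_Sch a f -> - (1 / sqrt 6) <= Cmod (gamma2 a) - Cmod (gamma1 a) <= 1 / 4.
Proof.
  intros (HA & p & Hp & _ & w & Hwd & Hw0 & Hw & Hpw).
  assert (H0 : inD 0%C) by (unfold inD; rewrite Cmod_0; lra).
  destruct (schwarz_function_expansion a f p w HA Hp Hw0 (Hwd _ H0) Hw Hpw)
    as (K & delta & Hd & _ & HK).
  pose proof (schwarz_second_coefficient w (a 2%nat) (2 * a 3%nat - 3 / 2 * a 2%nat ^ 2)%C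
    Hwd Hw (ex_intro _ K (ex_intro _ delta (conj (proj1 Hd) HK)))) as HS.
  rewrite gamma2_eq. unfold gamma1.
  set (c2 := (2 * a 3%nat - 3 / 2 * a 2%nat ^ 2)%C) in *.
  set (c1 := a 2%nat) in *.
  unfold Cdiv. rewrite !Cmod_mult, !Cmod_inv, !Cmod_R, !Rabs_pos_eq
    by (try lra; apply RtoC_neq_0; lra).
  set (x := Cmod c1) in *.
  assert (Hx : 0 <= x) by apply Cmod_ge_0.
  pose proof (Cmod_ge_0 c2) as Hc2.
  assert (E : Cmod (c1 * c1 * / 2) = x * x / 2).
  { rewrite !Cmod_mult, Cmod_inv, Cmod_R, Rabs_pos_eq by (try lra; apply RtoC_neq_0; lra).
    reflexivity. }
  pose proof (Cmod_triangle c2 (c1 * c1 * / 2)) as T1. rewrite E in T1.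
  pose proof (Cmod_triangle (c2 + c1 * c1 * / 2) (- c2)) as T2.
  replace (c2 + c1 * c1 * / 2 + - c2)%C with (c1 * c1 * / 2)%C in T2 by ring.
  rewrite E, Cmod_opp in T2.
  pose proof (Cmod_ge_0 (c2 + c1 * c1 * / 2)) as T3.
  set (g := Cmod (c2 + c1 * c1 * / 2)) in *.
  destruct sqrt6_bounds as [S1 S2]. set (s := 1 / sqrt 6) in *.
  simpl in HS, S1.
  split; [|nra].
  (* Up to [2 s = sqrt (2/3)] the trivial [|gamma2| >= 0] suffices; beyond it the reverse triangle
     inequality [T2] takes over. *)
  destruct (Rle_dec x (2 * s)) as [Hle|Hgt]; [lra|].
  (* As [4 s^2 = 2/3], this product times [3/8] equals [(3 x^2 - 2)/8 - x/2 + s]. The second factor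
     is positive because [x > 2 s > 2/3]. *)
  assert (0 <= (x - 2 * s) * (x + 2 * s - 4 / 3)) by (apply Rmult_le_pos; lra).
  nra.
Qed.

(** * Power series on the unit disk *)

Lemma is_Cseries_congr (a b : nat -> C) (l l' : C) :
  (forall n, a n = b n) -> l = l' -> is_Cseries a l -> is_Cseries b l'.
Proof. intros E <-. now apply is_series_ext. Qed.

Lemma is_Cseries_cons (a : nat -> C) (l : C) :
  is_Cseries (fun n => a (S n)) l -> is_Cseries a (a 0%nat + l)%C.
Proof.
  intros H.
  enough (E : l = plus (a 0%nat + l)%C (opp (a 0%nat))) by
    (rewrite E in H; exact (is_series_decr_1 a _ H)).
  unfold plus, opp; simpl. ring.
Qed.

Lemma is_Cseries_tail (a : nat -> C) (l : C) :
  is_Cseries a l -> is_Cseries (fun n => a (S n)) (l - a 0%nat)%C.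
Proof.
  intros H.
  enough (E : l = plus (l - a 0%nat)%C (a 0%nat)) by
    (rewrite E in H; exact (is_series_incr_1 a _ H)).
  unfold plus; simpl. ring.
Qed.

Lemma is_Cseries_plus (a b : nat -> C) (l m : C) :
  is_Cseries a l -> is_Cseries b m -> is_Cseries (fun n => a n + b n)%C (l + m)%C.
Proof. intros H H'. exact (is_series_plus _ _ _ _ H H'). Qed.

Lemma is_Cseries_scal (c : C) (a : nat -> C) (l : C) :
  is_Cseries a l -> is_Cseries (fun n => c * a n)%C (c * l)%C.
Proof. intros H. exact (is_series_scal c _ _ H). Qed.

Definition psum (a : nat -> C) (f : C -> C) : Prop :=
  forall z, inD z -> is_Cseries (fun n => a n * z ^ n)%C (f z).

Lemma psum_at_0 (a : nat -> C) (f : C -> C) : psum a f -> f 0%C = a 0%nat.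
Proof.
  intros H. apply (is_Cseries_unique (fun n => a n * 0 ^ n)%C).
  - apply H. unfold inD. rewrite Cmod_0. lra.
  - apply is_Cseries_iff.
    assert (E : forall (u : nat -> R), (forall n, u (S n) = 0) -> is_series u (u 0%nat)).
    { intros u Hu. enough (HL : is_lim_seq (sum_n u) (u 0%nat)) by exact HL.
      apply (is_lim_seq_ext (fun _ => u 0%nat)); [|apply is_lim_seq_const].
      intros n. induction n as [|n IH]; [now rewrite sum_O|].
      rewrite sum_Sn, <- IH, Hu. unfold plus; simpl. ring. }
    replace (a 0%nat) with (a 0%nat * 0 ^ 0)%C by (simpl; ring).
    assert (Hn : forall n, (a (S n) * 0 ^ S n)%C = 0%C) by (intros n; simpl; ring).
    split.
    + apply (E (fun n => Re (a n * 0 ^ n)%C)). intros n. now rewrite Hn.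
    + apply (E (fun n => Im (a n * 0 ^ n)%C)). intros n. now rewrite Hn.
Qed.

(** Boundedness of the terms at a point between [r] and 1 transfers the question to the real series
    of moduli, whose radius of convergence is available. *)
Lemma psum_lt_radius (a : nat -> C) (f : C -> C) (r : R) :
  psum a f -> 0 <= r < 1 -> Rbar_lt r (CV_radius (fun n => Cmod (a n))).
Proof.
  intros H Hr. set (s := (1 + r) / 2).
  assert (Hs : inD (RtoC s)) by (unfold inD, s; rewrite Cmod_R, Rabs_pos_eq; lra).
  destruct (is_Cseries_terms_bounded _ _ (H _ Hs)) as (M & _ & HM).
  apply Rbar_lt_le_trans with s; [simpl; unfold s; lra|].
  apply (proj1 (CV_radius_bounded _)). exists M. intros n.
  specialize (HM n). rewrite Cmod_mult, Cmod_pow, Cmod_R in HM.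
  rewrite Rabs_mult, <- RPow_abs, (Rabs_pos_eq (Cmod (a n))) by apply Cmod_ge_0. exact HM.
Qed.

Lemma psum_of_bounded (a : nat -> C) :
  (forall r, 0 < r < 1 -> exists M, forall n, Cmod (a n) * r ^ n <= M) ->
  exists f, psum a f.
Proof.
  intros H.
  exists (fun z => (Series (fun n => Re (a n * z ^ n)%C), Series (fun n => Im (a n * z ^ n)%C))).
  intros z Hz. unfold inD in Hz. pose proof (Cmod_ge_0 z).
  assert (Hex : ex_series (fun n => Rabs (Cmod (a n) * Cmod z ^ n))).
  { apply (CV_disk_inside (fun n => Cmod (a n))).
    set (s := (1 + Cmod z) / 2).
    apply Rbar_lt_le_trans with s.
    - rewrite Rabs_pos_eq by lra. simpl; unfold s; lra.
    - destruct (H s) as [M HM]; [unfold s; lra|].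
      apply (proj1 (CV_radius_bounded _)). exists M. intros n.
      rewrite Rabs_pos_eq; [apply HM|].
      apply Rmult_le_pos; [apply Cmod_ge_0|apply pow_le; unfold s; lra]. }
  apply is_Cseries_iff. split; apply Series_correct;
    refine (@ex_series_le R_AbsRing R_CompleteNormedModule _ _ _ Hex); intros n;
    rewrite <- Cmod_pow, <- Cmod_mult, (Rabs_pos_eq (Cmod _)) by apply Cmod_ge_0.
  - apply re_le_Cmod.
  - apply Im_le_Cmod.
Qed.

(** * Cauchy products and operations on power series *)

Definition conv (a b : nat -> C) (n : nat) : C :=
  @sum_n C_NormedModule (fun k => a k * b (n - k)%nat)%C n.

Lemma sum_n_minus (u v : nat -> R) (n : nat) :
  sum_n (fun k => u k - v k) n = sum_n u n - sum_n v n.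
Proof.
  induction n as [|n IH]; [now rewrite !sum_O|].
  rewrite !sum_Sn, IH. unfold plus; simpl. ring.
Qed.

Lemma is_Cseries_mult (a b : nat -> C) (la lb : C) :
  is_Cseries a la -> is_Cseries b lb ->
  ex_series (fun n => Cmod (a n)) -> ex_series (fun n => Cmod (b n)) ->
  is_Cseries (conv a b) (la * lb)%C.
Proof.
  intros Ha Hb Aa Ab. apply is_Cseries_iff in Ha, Hb.
  destruct Ha as [Ha1 Ha2], Hb as [Hb1 Hb2].
  assert (HR : forall u, ex_series (fun n => Cmod (u n)) -> ex_series (fun n => Rabs (Re (u n)))).
  { intros u Hu. refine (@ex_series_le R_AbsRing R_CompleteNormedModule _ _ _ Hu).
    intros n. change (Rabs (Rabs (Re (u n))) <= Cmod (u n)). rewrite Rabs_Rabsolu. apply re_le_Cmod. }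
  assert (HI : forall u, ex_series (fun n => Cmod (u n)) -> ex_series (fun n => Rabs (Im (u n)))).
  { intros u Hu. refine (@ex_series_le R_AbsRing R_CompleteNormedModule _ _ _ Hu).
    intros n. change (Rabs (Rabs (Im (u n))) <= Cmod (u n)). rewrite Rabs_Rabsolu. apply Im_le_Cmod. }
  pose proof (is_series_mult _ _ _ _ Ha1 Hb1 (HR _ Aa) (HR _ Ab)) as P1.
  pose proof (is_series_mult _ _ _ _ Ha2 Hb2 (HI _ Aa) (HI _ Ab)) as P2.
  pose proof (is_series_mult _ _ _ _ Ha1 Hb2 (HR _ Aa) (HI _ Ab)) as P3.
  pose proof (is_series_mult _ _ _ _ Ha2 Hb1 (HI _ Aa) (HR _ Ab)) as P4.
  apply is_Cseries_iff. split.
  - refine (is_series_ext _ _ _ _ (is_series_minus _ _ _ _ P1 P2)). intros n.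
    unfold conv. rewrite sum_n_Re_Im, <- !sum_n_Reals. cbn [Re fst].
    exact (eq_sym (sum_n_minus (fun k => Re (a k) * Re (b (n - k)%nat))
      (fun k => Im (a k) * Im (b (n - k)%nat)) n)).
  - refine (is_series_ext _ _ _ _ (is_series_plus _ _ _ _ P3 P4)). intros n.
    unfold conv. rewrite sum_n_Re_Im, <- !sum_n_Reals. cbn [Im snd].
    exact (eq_sym (sum_n_plus (fun k => Re (a k) * Im (b (n - k)%nat))
      (fun k => Im (a k) * Re (b (n - k)%nat)) n)).
Qed.

Lemma psum_abs (a : nat -> C) (f : C -> C) (z : C) :
  psum a f -> inD z -> ex_series (fun n => Cmod (a n * z ^ n)%C).
Proof.
  intros H Hz.
  eapply ex_series_ext; [|apply (CV_disk_inside (fun n => Cmod (a n)) (Cmod z))].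
  - intros n. simpl. rewrite Rabs_pos_eq, Cmod_mult, Cmod_pow; [reflexivity|].
    apply Rmult_le_pos; [apply Cmod_ge_0|apply pow_le, Cmod_ge_0].
  - rewrite Rabs_pos_eq by apply Cmod_ge_0. apply (psum_lt_radius a f); [exact H|].
    split; [apply Cmod_ge_0|exact Hz].
Qed.

Lemma sum_n_Cmult_r (u : nat -> C) (c : C) (n : nat) :
  (@sum_n C_NormedModule u n * c)%C = @sum_n C_NormedModule (fun k => u k * c)%C n.
Proof.
  induction n as [|n IH]; [now rewrite !sum_O|].
  rewrite !sum_Sn, <- IH. unfold plus; simpl. ring.
Qed.

Lemma psum_mult (a b : nat -> C) (f g : C -> C) :
  psum a f -> psum b g -> psum (conv a b) (fun z => f z * g z)%C.
Proof.
  intros Ha Hb z Hz.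
  refine (is_series_ext _ _ _ _ (is_Cseries_mult _ _ _ _ (Ha z Hz) (Hb z Hz)
    (psum_abs a f z Ha Hz) (psum_abs b g z Hb Hz))).
  intros n. unfold conv. rewrite sum_n_Cmult_r. apply sum_n_ext_loc.
  intros k Hk.
  assert (E : (a k * z ^ k * (b (n - k)%nat * z ^ (n - k)) = a k * b (n - k)%nat * z ^ n)%C).
  { replace (z ^ n)%C with (z ^ k * z ^ (n - k))%C; [ring|].
    rewrite <- Cpow_add_r. f_equal. lia. }
  exact E.
Qed.

Lemma psum_plus (a b : nat -> C) (f g : C -> C) :
  psum a f -> psum b g -> psum (fun n => a n + b n)%C (fun z => f z + g z)%C.
Proof.
  intros Ha Hb z Hz. refine (is_Cseries_congr _ _ _ _ _ eq_refl
    (is_Cseries_plus _ _ _ _ (Ha z Hz) (Hb z Hz))).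
  intros n. ring.
Qed.

Lemma psum_scal (c : C) (a : nat -> C) (f : C -> C) :
  psum a f -> psum (fun n => c * a n)%C (fun z => c * f z)%C.
Proof.
  intros Ha z Hz. refine (is_Cseries_congr _ _ _ _ _ eq_refl (is_Cseries_scal c _ _ (Ha z Hz))).
  intros n. ring.
Qed.

Lemma psum_ext (a : nat -> C) (f g : C -> C) :
  (forall z, inD z -> f z = g z) -> psum a f -> psum a g.
Proof. intros E H z Hz. rewrite <- E by exact Hz. now apply H. Qed.

Lemma psum_shift (a : nat -> C) (f : C -> C) :
  psum a f -> psum (fun n => match n with O => 0 | S k => a k end)%C (fun z => z * f z)%C.
Proof.
  intros H z Hz.
  refine (is_Cseries_congr _ _ _ _ (fun n => eq_refl) _ (is_Cseries_cons _ (z * f z)%C _)).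
  - simpl. ring.
  - refine (is_Cseries_congr _ _ _ _ _ eq_refl (is_Cseries_scal z _ _ (H z Hz))).
    intros n. simpl. ring.
Qed.

(** Yields quotients such as [(h(w) - 1)/z] as power series, with no division at the origin. *)
Lemma psum_unshift (a : nat -> C) (f : C -> C) :
  psum a f -> exists g, psum (fun n => a (S n)) g /\
    forall z, inD z -> f z = (a 0%nat + z * g z)%C.
Proof.
  intros H. destruct (psum_of_bounded (fun n => a (S n))) as [g Hg].
  - intros r Hr.
    assert (Hrd : inD (RtoC r)) by (unfold inD; rewrite Cmod_R, Rabs_pos_eq; lra).
    destruct (is_Cseries_terms_bounded _ _ (H _ Hrd)) as (M & _ & HM).
    exists (M / r). intros n. specialize (HM (S n)).
    rewrite Cmod_mult, Cmod_pow, Cmod_R, Rabs_pos_eq in HM by lra.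
    apply Rmult_le_reg_r with r; [lra|]. unfold Rdiv.
    rewrite (Rmult_assoc M), Rinv_l by lra. simpl in HM. lra.
  - exists g. split; [exact Hg|]. intros z Hz.
    apply (is_Cseries_unique _ _ _ (H z Hz)).
    refine (is_Cseries_congr _ _ _ _ (fun n => eq_refl) _ (is_Cseries_cons _ (z * g z)%C _)).
    + simpl. ring.
    + refine (is_Cseries_congr _ _ _ _ _ eq_refl (is_Cseries_scal z _ _ (Hg z Hz))).
      intros n. simpl. ring.
Qed.

(** The factor [(n+2)(n+1)], twice the sharp one, is the coefficient of the second formal
    derivative, so that these bounds sum to its value at [r]. *)
Lemma Cpow_second_difference (w z : C) (r : R) (n : nat) :
  Cmod z <= r -> Cmod w <= r ->
  Cmod (w ^ S (S n) - z ^ S (S n) - INR (S (S n)) * z ^ S n * (w - z))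
    <= INR (S (S n)) * INR (S n) * r ^ n * Cmod (w - z) ^ 2.
Proof.
  intros Hz Hw. pose proof (Cmod_ge_0 z). pose proof (Cmod_ge_0 w).
  pose proof (Cmod_ge_0 (w - z)).
  induction n as [|n IH].
  - replace (w ^ 2 - z ^ 2 - INR 2 * z ^ 1 * (w - z))%C with ((w - z) * (w - z))%C.
    + rewrite Cmod_mult. simpl. nra.
    + replace (RtoC (INR 2)) with (RtoC 2) by (f_equal; simpl; ring). simpl. ring.
  - set (m := S (S n)) in *.
    replace (w ^ S m - z ^ S m - INR (S m) * z ^ m * (w - z))%C
      with (w * (w ^ m - z ^ m - INR m * z ^ S n * (w - z))
        + INR m * z ^ S n * ((w - z) * (w - z)))%C.
    2:{ rewrite (S_INR m), RtoC_plus. change (z ^ S m)%C with (z * z ^ m)%C.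
        change (w ^ S m)%C with (w * w ^ m)%C. unfold m.
        change (z ^ S (S n))%C with (z * z ^ S n)%C. ring. }
    eapply Rle_trans; [apply Cmod_triangle|].
    rewrite !Cmod_mult, Cmod_pow, Cmod_R, (Rabs_pos_eq (INR m)) by apply pos_INR.
    assert (Hm : INR m = INR (S n) + 1) by (unfold m; apply S_INR).
    pose proof (pos_INR (S n)) as Hn.
    assert (Hp : Cmod z ^ S n <= r ^ S n) by (apply pow_incr; lra).
    assert (Hr : 0 <= r ^ S n) by (apply pow_le; lra).
    apply Rle_trans with (r * (INR m * INR (S n) * r ^ n * Cmod (w - z) ^ 2)
      + INR m * r ^ S n * (Cmod (w - z) * Cmod (w - z))).
    + apply Rplus_le_compat.
      * apply Rmult_le_compat; auto. apply Cmod_ge_0.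
      * apply Rmult_le_compat_r; [nra|]. apply Rmult_le_compat_l; [lra|exact Hp].
    + replace (r * (INR m * INR (S n) * r ^ n * Cmod (w - z) ^ 2)
        + INR m * r ^ S n * (Cmod (w - z) * Cmod (w - z)))
        with (INR m * (INR (S n) + 1) * r ^ S n * Cmod (w - z) ^ 2) by (simpl; ring).
      rewrite <- Hm, (S_INR m).
      apply Rmult_le_compat_r; [apply pow_le; lra|]. apply Rmult_le_compat_r; [exact Hr|]. nra.
Qed.

Lemma psum_deriv (a : nat -> C) (f : C -> C) :
  psum a f -> exists f', psum (fun n => INR (S n) * a (S n))%C f' /\
    forall z, inD z -> has_cderiv f z (f' z).
Proof.
  intros H.
  destruct (psum_of_bounded (fun n => INR (S n) * a (S n))%C) as [f' Hf'].
  { intros r Hr.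
    assert (Hrad : Rbar_lt (Rabs r) (CV_radius (PS_derive (fun n => Cmod (a n))))).
    { rewrite CV_radius_derive, Rabs_pos_eq by lra. apply (psum_lt_radius a f); [exact H|lra]. }
    apply CV_disk_inside in Hrad.
    destruct (@filterlim_bounded R_AbsRing R_NormedModule
      (fun n => Rabs (PS_derive (fun n => Cmod (a n)) n * r ^ n))) as [M HM].
    { exists 0. exact (ex_series_lim_0 _ Hrad). }
    exists M. intros n. specialize (HM n). eapply Rle_trans; [|exact HM].
    change norm with Rabs. rewrite Rabs_Rabsolu.
    rewrite Cmod_mult, Cmod_R, (Rabs_pos_eq (INR _)) by apply pos_INR. apply Rle_abs. }
  exists f'. split; [exact Hf'|]. intros z Hz.
  pose proof (Cmod_ge_0 z) as Hz0. unfold inD in Hz.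
  set (r := (1 + Cmod z) / 2). assert (Hr : 0 < r < 1 /\ Cmod z < r) by (unfold r; lra).
  (* Formal differentiation preserves the radius of convergence, so the sum [B] of this series at
     [r], taken between [|z|] and 1, is a uniform constant for the quadratic remainder. *)
  set (A := PS_derive (PS_derive (fun n => Cmod (a n)))).
  assert (HA : ex_series (fun n => Rabs (A n * r ^ n))).
  { apply CV_disk_inside. unfold A. rewrite !CV_radius_derive, Rabs_pos_eq by lra.
    apply (psum_lt_radius a f); [exact H|lra]. }
  destruct HA as [B HB].
  assert (HB0 : 0 <= B).
  { pose proof (is_lim_seq_incr_compare _ _ HB) as HI.
    eapply Rle_trans; [|apply (HI ltac:(intros n; rewrite sum_Sn; unfold plus; simpl;
      pose proof (Rabs_pos (A (S n) * (r * r ^ n))); lra) 0%nat)].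
    rewrite sum_O. apply Rabs_pos. }
  assert (Hmain : forall w, Cmod w <= r ->
    Cmod (f w - f z - f' z * (w - z)) <= B * Cmod (w - z) ^ 2).
  { intros w Hw.
    assert (S1 : is_Cseries (fun n => INR n * a n * z ^ pred n)%C (f' z)).
    { refine (is_Cseries_congr _ _ _ _ (fun n => eq_refl) _
        (is_Cseries_cons (fun n => INR n * a n * z ^ pred n)%C _ (Hf' z Hz))).
      simpl. ring. }
    assert (S2 : is_Cseries (fun n => a n * (w ^ n - z ^ n - INR n * z ^ pred n * (w - z)))%C
      (f w - f z - f' z * (w - z))%C).
    { refine (is_Cseries_congr _ _ _ _ _ _ (is_Cseries_plus _ _ _ _ (H w ltac:(unfold inD; lra))
        (is_Cseries_plus _ _ _ _ (is_Cseries_scal (- (1))%C _ _ (H z Hz))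
          (is_Cseries_scal (- (w - z))%C _ _ S1)))).
      - intros n. simpl. ring.
      - ring. }
    assert (S3 : is_Cseries (fun n => a (2 + n)%nat
        * (w ^ (2 + n) - z ^ (2 + n) - INR (2 + n) * z ^ S n * (w - z)))%C
      (f w - f z - f' z * (w - z))%C).
    { refine (is_Cseries_congr _ _ _ _ (fun n => eq_refl) _
        (is_Cseries_tail _ _ (is_Cseries_tail _ _ S2))).
      simpl. ring. }
    refine (is_Cseries_le _ _ _ _ S3 (is_series_scal_r (Cmod (w - z) ^ 2) _ _ HB) _).
    intros n. rewrite Cmod_mult.
    pose proof (Cpow_second_difference w z r n ltac:(lra) Hw) as HD.
    apply Rle_trans with (Cmod (a (2 + n)%nat) * (INR (S (S n)) * INR (S n) * r ^ n * Cmod (w - z) ^ 2)).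
    - apply Rmult_le_compat_l; [apply Cmod_ge_0|exact HD].
    - eapply Rle_trans; [|apply Rmult_le_compat_r; [apply pow_le, Cmod_ge_0|apply Rle_abs]].
      right. unfold A, PS_derive. change (2 + n)%nat with (S (S n)). ring. }
  apply has_cderiv_eps. intros eps Heps.
  exists (Rmin (r - Cmod z) (eps / (B + 1))). split.
  { apply Rmin_glb_lt; [lra|]. apply Rdiv_lt_0_compat; lra. }
  intros w Hw. apply Rmin_Rgt_l in Hw. destruct Hw as [Hw1 Hw2].
  pose proof (Cmod_triangle (w - z) z) as T. replace (w - z + z)%C with w in T by ring.
  eapply Rle_trans; [apply Hmain; lra|].
  apply (Rmult_lt_compat_r (B + 1)) in Hw2; [|lra].
  unfold Rdiv in Hw2. rewrite Rmult_assoc, Rinv_l in Hw2 by lra.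
  pose proof (Cmod_ge_0 (w - z)). simpl. nra.
Qed.

(** * Extremal functions *)

(* Course-of-values recursion: the values at [k <= n] of [ode_table q n] are final. *)
Fixpoint ode_table (q : nat -> C) (n : nat) : nat -> C :=
  match n with
  | O => fun _ => 1%C
  | S m => fun k =>
      if (k <=? m)%nat then ode_table q m k else (conv q (ode_table q m) m / INR (S m))%C
  end.

Definition ode_coef (q : nat -> C) (n : nat) : C := ode_table q n n.

Lemma ode_table_stable (q : nat -> C) (n k : nat) :
  (k <= n)%nat -> ode_table q n k = ode_coef q k.
Proof.
  induction n as [|n IH]; intros Hk.
  - now replace k with 0%nat by lia.
  - destruct (Nat.eq_dec k (S n)) as [-> | Hne]; [reflexivity|].
    simpl. destruct (Nat.leb_spec k n); [now apply IH|lia].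
Qed.

Lemma ode_coef_S (q : nat -> C) (n : nat) :
  (INR (S n) * ode_coef q (S n))%C = conv q (ode_coef q) n.
Proof.
  unfold ode_coef at 1. cbn [ode_table].
  destruct (Nat.leb_spec (S n) n); [lia|].
  assert (E : conv q (ode_table q n) n = conv q (ode_coef q) n).
  { apply sum_n_ext_loc. intros k Hk. rewrite ode_table_stable; [reflexivity|lia]. }
  rewrite E. field. apply RtoC_neq_0, not_0_INR. lia.
Qed.

(** The weight splits as [r^n = r^k r^(n-k)], one factor for each sequence. *)
Lemma conv_bound (q b : nat -> C) (r K S : R) (n : nat) :
  0 <= r -> 0 <= K -> sum_n (fun k => Cmod (q k) * r ^ k) n <= S ->
  (forall j, (j <= n)%nat -> Cmod (b j) * r ^ j <= K) ->
  Cmod (conv q b n) * r ^ n <= S * K.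
Proof.
  intros Hr HK HS Hb.
  assert (Hgen : forall (u : nat -> C) (v : nat -> R) m, (m <= n)%nat ->
    (forall k, (k <= m)%nat -> Cmod (u k) * r ^ n <= v k) ->
    Cmod (@sum_n C_NormedModule u m) * r ^ n <= sum_n v m).
  { intros u v m. induction m as [|m IH]; intros Hm Huv.
    - rewrite !sum_O. now apply Huv.
    - rewrite !sum_Sn.
      apply Rle_trans with ((Cmod (@sum_n C_NormedModule u m) + Cmod (u (Datatypes.S m))) * r ^ n).
      + apply Rmult_le_compat_r; [now apply pow_le|]. apply Cmod_triangle.
      + rewrite Rmult_plus_distr_r. apply Rplus_le_compat.
        * apply IH; [lia|]. intros k Hk. apply Huv. lia.
        * apply Huv. lia. }
  apply Rle_trans with (sum_n (fun k => K * (Cmod (q k) * r ^ k)) n).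
  - apply Hgen; [lia|]. intros k Hk. rewrite Cmod_mult.
    replace (r ^ n) with (r ^ k * r ^ (n - k)) by (rewrite <- pow_add; f_equal; lia).
    replace (Cmod (q k) * Cmod (b (n - k)%nat) * (r ^ k * r ^ (n - k)))
      with (Cmod (b (n - k)%nat) * r ^ (n - k) * (Cmod (q k) * r ^ k)) by ring.
    apply Rmult_le_compat_r; [|apply Hb; lia].
    apply Rmult_le_pos; [apply Cmod_ge_0|now apply pow_le].
  - rewrite (sum_n_mult_l K). unfold mult; simpl. rewrite Rmult_comm.
    now apply Rmult_le_compat_r.
Qed.

(* The factor [n + 1] in the recursion eventually beats the sum of [|q_k| r^k], so from some
   rank on [|b_n| r^n] never exceeds the maximum of its predecessors. *)
Lemma ode_coef_bounded (q : nat -> C) (Q : C -> C) (r : R) :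
  psum q Q -> 0 < r < 1 -> exists M, forall n, Cmod (ode_coef q n) * r ^ n <= M.
Proof.
  intros HQ Hr. set (b := ode_coef q).
  assert (Hrd : inD (RtoC r)) by (unfold inD; rewrite Cmod_R, Rabs_pos_eq; lra).
  destruct (psum_abs q Q r HQ Hrd) as [s Hs].
  assert (Hss : forall n, sum_n (fun k => Cmod (q k) * r ^ k) n <= s).
  { intros n. rewrite (sum_n_ext _ (fun k => Cmod (q k * r ^ k)%C)).
    - apply is_lim_seq_incr_compare; [exact Hs|]. intros k. rewrite sum_Sn.
      unfold plus; simpl. pose proof (Cmod_ge_0 (q (S k) * (r * r ^ k))). lra.
    - intros k. rewrite Cmod_mult, Cmod_pow, Cmod_R, Rabs_pos_eq by lra. reflexivity. }
  destruct (INR_unbounded s) as [N HN].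
  set (M := sum_n (fun j => Cmod (b j) * r ^ j) N). exists M.
  assert (Hpos : forall j, 0 <= Cmod (b j) * r ^ j)
    by (intros j; apply Rmult_le_pos; [apply Cmod_ge_0|apply pow_le; lra]).
  assert (Hsmall : forall n j, (j <= n)%nat ->
    Cmod (b j) * r ^ j <= sum_n (fun j => Cmod (b j) * r ^ j) n
    /\ 0 <= sum_n (fun j => Cmod (b j) * r ^ j) n).
  { induction n as [|n IH]; intros j Hj.
    - replace j with 0%nat by lia. rewrite sum_O. split; [lra|apply Hpos].
    - rewrite sum_Sn. unfold plus; simpl. pose proof (Hpos (S n)) as HS. simpl in HS.
      destruct (Nat.eq_dec j (S n)) as [-> | Hne].
      + destruct (IH n (le_n n)). simpl. lra.
      + destruct (IH j ltac:(lia)). lra. }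
  assert (HM : 0 <= M) by apply (Hsmall N 0%nat (Nat.le_0_l N)).
  enough (H : forall n j, (j <= n)%nat -> Cmod (b j) * r ^ j <= M) by (intros n; now apply (H n)).
  induction n as [|n IH]; intros j Hj.
  - apply Hsmall. lia.
  - destruct (Nat.le_gt_cases j N) as [HjN|HjN]; [now apply Hsmall|].
    destruct (Nat.eq_dec j (S n)) as [-> | Hne]; [|apply IH; lia].
    pose proof (conv_bound q b r M s n ltac:(lra) HM (Hss n) IH) as HC.
    unfold b in HC. rewrite <- ode_coef_S in HC. fold b in HC.
    rewrite Cmod_mult, Cmod_R, Rabs_pos_eq in HC by apply pos_INR.
    assert (HsI : s < INR (S n)).
    { apply Rlt_trans with (INR N); [exact HN|]. now apply lt_INR. }
    assert (HI : 0 < INR (S n)) by (apply lt_0_INR; lia).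
    apply Rmult_le_reg_l with (INR (S n)); [exact HI|].
    replace (INR (S n) * (Cmod (b (S n)) * r ^ S n))
      with (r * (INR (S n) * Cmod (b (S n)) * r ^ n)) by (simpl pow; ring).
    assert (0 <= INR (S n) * Cmod (b (S n)) * r ^ n).
    { apply Rmult_le_pos; [apply Rmult_le_pos; [lra|apply Cmod_ge_0]|apply pow_le; lra]. }
    assert (s * M <= INR (S n) * M) by nra. nra.
Qed.

(** The recursion [ode_coef_S] is the comparison of coefficients in [y' = Q y], so the
    differentiated series and the Cauchy product have the same sum. *)
Lemma linear_ode (q : nat -> C) (Q : C -> C) :
  psum q Q -> exists b y, psum b y /\ y 0%C = 1%C /\ b 0%nat = 1%C /\
    forall z, inD z -> has_cderiv y z (Q z * y z)%C.
Proof.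
  intros HQ. set (b := ode_coef q).
  destruct (psum_of_bounded b) as [y Hy].
  { intros r Hr. exact (ode_coef_bounded q Q r HQ Hr). }
  exists b, y. split; [exact Hy|]. split; [exact (psum_at_0 b y Hy)|]. split; [reflexivity|].
  destruct (psum_deriv b y Hy) as (y' & Hy' & Hd).
  intros z Hz. replace (Q z * y z)%C with (y' z); [now apply Hd|].
  apply (is_Cseries_unique (fun n => (INR (S n) * b (S n)) * z ^ n)%C); [now apply Hy'|].
  refine (is_Cseries_congr _ _ _ _ _ eq_refl (psum_mult q b Q y HQ Hy z Hz)).
  intros n. cbv beta. unfold b. now rewrite ode_coef_S.
Qed.

(** Restriction to the segment from 0 to [z] reduces to one real variable. The 1-Lipschitz
    functional [phi] treats real and imaginary parts at once. *)
Lemma deriv_zero_constant (g : C -> C) :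
  (forall z, inD z -> has_cderiv g z 0) -> forall z, inD z -> g z = g 0%C.
Proof.
  intros Hg z Hz. unfold inD in Hz. pose proof (Cmod_ge_0 z).
  assert (Hpath : forall (phi : C -> R),
    (forall u v, Rabs (phi u - phi v) <= Cmod (u - v)) -> phi (g z) = phi (g 0%C)).
  { intros phi Hphi.
    assert (Hder : forall t : R, Rabs t <= 1 -> is_derive (fun s : R => phi (g (s * z)%C)) t 0).
    { intros t Ht. apply is_derive_Reals. intros eps Heps.
      assert (Htz : inD (t * z)%C).
      { unfold inD. rewrite Cmod_mult, Cmod_R. pose proof (Rabs_pos t). nra. }
      pose proof (Hg _ Htz) as Hd. rewrite has_cderiv_eps in Hd.
      destruct (Hd (eps / 2) ltac:(lra)) as (delta & Hdelta & Hw).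
      exists (mkposreal delta Hdelta). intros h Hh Hhd. simpl in Hhd.
      assert (Habs : 0 < Rabs h) by now apply Rabs_pos_lt.
      assert (E : Cmod ((t + h)%R * z - t * z) = Rabs h * Cmod z).
      { replace ((t + h)%R * z - t * z)%C with (h * z)%C by (rewrite RtoC_plus; ring).
        now rewrite Cmod_mult, Cmod_R. }
      specialize (Hw ((t + h)%R * z)%C). rewrite E in Hw. specialize (Hw ltac:(nra)).
      replace (g ((t + h)%R * z)%C - g (t * z)%C - 0 * ((t + h)%R * z - t * z))%C
        with (g ((t + h)%R * z)%C - g (t * z)%C)%C in Hw by ring.
      pose proof (Hphi (g ((t + h)%R * z)%C) (g (t * z)%C)) as HP.
      rewrite Rminus_0_r. unfold Rdiv. rewrite Rabs_mult, Rabs_inv.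
      apply Rmult_lt_reg_r with (Rabs h); [exact Habs|].
      rewrite Rmult_assoc, Rinv_l by lra.
      assert (eps / 2 * (Rabs h * Cmod z) <= eps / 2 * Rabs h)
        by (apply Rmult_le_compat_l; nra).
      assert (0 < eps * Rabs h) by now apply Rmult_lt_0_compat.
      lra. }
    assert (HV := bounded_variation (fun s : R => phi (g (s * z)%C)) (fun _ => 0) 0 0 1).
    cbv beta in HV. rewrite Rmult_0_l in HV.
    replace (RtoC 1 * z)%C with z in HV by ring. replace (RtoC 0 * z)%C with (RtoC 0) in HV by ring.
    assert (HR : Rabs (phi (g z) - phi (g 0%C)) <= 0).
    { apply HV. intros t Ht. rewrite !Rminus_0_r, Rabs_R1 in Ht.
      split; [now apply Hder|]. rewrite Rabs_R0. lra. }
    pose proof (Rabs_pos (phi (g z) - phi (g 0%C))).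
    apply Rminus_diag_uniq. destruct (Req_dec (phi (g z) - phi (g 0%C)) 0) as [E|E]; [exact E|].
    apply Rabs_pos_lt in E. lra. }
  pose proof (Hpath (fun u => Re u) (fun u v => re_le_Cmod (u - v)%C)) as H1.
  pose proof (Hpath (fun u => Im u) (fun u v => Im_le_Cmod (u - v)%C)) as H2.
  destruct (g z), (g 0%C). simpl in *. now f_equal.
Qed.

(** Instead of substituting one series into another, solve [y' = w' y] with [y(0) = 1]: the product
    [y exp(-w)] has derivative zero, so [y = exp(w)]. *)
Lemma psum_exp (c : nat -> C) (w : C -> C) :
  psum c w -> w 0%C = 0%C -> exists e, psum e (fun z => Cexp (w z)).
Proof.
  intros Hw Hw0. destruct (psum_deriv c w Hw) as (w' & Hw' & Hd).
  destruct (linear_ode _ _ Hw') as (e & y & Hy & Hy0 & _ & Hyd).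
  exists e. refine (psum_ext _ _ _ _ Hy). intros z Hz.
  assert (HC : (y z * Cexp (- (1) * w z))%C = 1%C).
  { rewrite (deriv_zero_constant (fun z => y z * Cexp (- (1) * w z))%C); [|clear z Hz|exact Hz].
    - rewrite Hy0, Hw0, Cmult_0_r, Cexp_0. ring.
    - intros z Hz.
      pose proof (has_cderiv_comp Cexp (fun z => - (1) * w z)%C z _ _ (Cexp_deriv _)
        (has_cderiv_scal (- (1))%C w z _ (Hd z Hz))) as D.
      refine (has_cderiv_val _ z _ _ _ (has_cderiv_mult _ _ z _ _ (Hyd z Hz) D)).
      ring. }
  transitivity (y z * Cexp (- (1) * w z) * Cexp (w z))%C.
  - rewrite <- Cmult_assoc, <- Cexp_add. replace (- (1) * w z + w z)%C with (RtoC 0) by ring.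
    rewrite Cexp_0. ring.
  - rewrite HC. ring.
Qed.

Lemma exists_Sch_of_schwarz (c : nat -> C) (w : C -> C) :
  psum c w -> w 0%C = 0%C -> (forall z, inD z -> Cmod (w z) < 1) ->
  exists a f, in_Sch a f /\
    bigO (fun z => w z - a 2%nat * z - (2 * a 3%nat - 3 / 2 * a 2%nat ^ 2) * z * z)%C 3.
Proof.
  intros Hc Hw0 Hw.
  destruct (psum_exp c w Hc Hw0) as [e1 He1].
  destruct (psum_exp (fun n => - (1) * c n)%C (fun z => - (1) * w z)%C) as [e2 He2].
  { now apply psum_scal. }
  { rewrite Hw0. ring. }
  pose proof (psum_plus _ _ _ _ Hc (psum_scal (/ 2)%C _ _ (psum_plus _ _ _ _ He1 He2))) as Hs.
  set (s := fun n => (c n + / 2 * (e1 n + e2 n))%C) in Hs.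
  assert (Hh : psum s (fun z => hch (w z))).
  { refine (psum_ext _ _ _ _ Hs). intros z Hz. unfold hch, Ccosh.
    replace (- w z)%C with (- (1) * w z)%C by ring. field. }
  assert (Hh0 : hch (w 0%C) = 1%C).
  { rewrite Hw0. unfold hch, Ccosh. replace (- 0)%C with (RtoC 0) by ring. rewrite Cexp_0. field. }
  assert (Hs0 : s 0%nat = 1%C) by (rewrite <- Hh0; symmetry; exact (psum_at_0 s _ Hh)).
  destruct (psum_unshift s _ Hh) as (Q & HQ & HhQ). rewrite Hs0 in HhQ.
  destruct (linear_ode _ _ HQ) as (b & y & Hy & Hy0 & Hb0 & Hyd).
  (* Here [y'] is not the derivative of [y] but the solution for [-Q]. The product [y y'] is
     constantly 1, so [y] has no zeros in the disk. *)
  destruct (linear_ode _ _ (psum_scal (- (1))%C _ _ HQ)) as (b' & y' & Hy' & Hy0' & _ & Hyd').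
  assert (Hyn : forall z, inD z -> y z <> 0%C).
  { intros z Hz E.
    assert (HC : (y z * y' z)%C = 1%C).
    { rewrite (deriv_zero_constant (fun z => y z * y' z)%C); [|clear z Hz E|exact Hz].
      - rewrite Hy0, Hy0'. ring.
      - intros z Hz.
        refine (has_cderiv_val _ z _ _ _ (has_cderiv_mult _ _ z _ _ (Hyd z Hz) (Hyd' z Hz))).
        ring. }
    rewrite E, Cmult_0_l in HC. injection HC. lra. }
  set (a := fun n => match n with O => RtoC 0 | S k => b k end).
  set (f := fun z => (z * y z)%C).
  assert (HA : in_A a f).
  { split; [reflexivity|]. split; [exact Hb0|]. exact (psum_shift b y Hy). }
  assert (Hp : is_zf'_over_f f (fun z => hch (w z))).
  { split; [exact Hh0|]. intros z Hz Hz0. split.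
    - apply Cmult_neq_0; [exact Hz0|now apply Hyn].
    - exists (1 * y z + z * (Q z * y z))%C. split.
      + exact (has_cderiv_mult _ _ z _ _ (has_cderiv_id z) (Hyd z Hz)).
      + rewrite (HhQ z Hz). unfold f. field. split; [now apply Hyn|exact Hz0]. }
  destruct (psum_deriv c w Hc) as (w' & _ & Hwd).
  destruct (psum_deriv s _ Hh) as (h' & _ & Hhd).
  exists a, f. split.
  - split; [exact HA|]. exists (fun z => hch (w z)). split; [exact Hp|].
    split.
    + intros z Hz. exists (h' z). exact (Hhd z Hz).
    + exists w. split; [intros z Hz; exists (w' z); exact (Hwd z Hz)|].
      split; [exact Hw0|]. split; [exact Hw|reflexivity].
  - apply (schwarz_function_expansion a f (fun z => hch (w z)) w HA Hp Hw0); auto.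
    exists (w' 0%C). apply Hwd. unfold inD. rewrite Cmod_0. lra.
Qed.

(** * Uniqueness of expansions and the Blaschke products *)

Lemma bigO_monomial_zero (k : C) (n : nat) : bigO (fun z => k * z ^ n)%C (S n) -> k = 0%C.
Proof.
  intros (K & d & Hd & HK & H). apply Cmod_eq_0.
  apply Rle_antisym; [|apply Cmod_ge_0]. apply le_epsilon. intros eps Heps.
  set (h := Rmin (d / 2) (eps / (K + 1))).
  assert (Hh : 0 < h) by (apply Rmin_glb_lt; [lra|apply Rdiv_lt_0_compat; lra]).
  assert (Hh1 : h <= d / 2) by apply Rmin_l. assert (Hh2 : h <= eps / (K + 1)) by apply Rmin_r.
  assert (Hm : Cmod h = h) by (rewrite Cmod_R; apply Rabs_pos_eq; lra).
  specialize (H h ltac:(lra)). rewrite Cmod_mult, Cmod_pow, Hm in H.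
  assert (Hp : 0 < h ^ n) by now apply pow_lt.
  assert (Hk : Cmod k <= K * h).
  { apply Rmult_le_reg_r with (h ^ n); [exact Hp|]. simpl in H. lra. }
  apply (Rmult_le_compat_r (K + 1)) in Hh2; [|lra].
  unfold Rdiv in Hh2. rewrite Rmult_assoc, Rinv_l in Hh2 by lra. nra.
Qed.

(** Allows [a2] and [a3] of a constructed [f] to be read off from [w], without computing the
    recursive coefficients. *)
Lemma bigO_coef_unique (w : C -> C) (c1 c2 d1 d2 : C) :
  bigO (fun z => w z - c1 * z - c2 * z * z)%C 3 ->
  bigO (fun z => w z - d1 * z - d2 * z * z)%C 3 -> c1 = d1 /\ c2 = d2.
Proof.
  intros Hc Hd.
  assert (H3 : bigO (fun z => (d1 - c1) * z ^ 1 + (d2 - c2) * z ^ 2)%C 3).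
  { refine (bigO_ext _ _ _ _ (bigO_plus _ _ _ Hc (bigO_scal (- (1))%C _ _ Hd))).
    intros z _. simpl. ring. }
  assert (H1 : (d1 - c1)%C = 0%C).
  { apply (bigO_monomial_zero _ 1).
    refine (bigO_ext _ _ _ _ (bigO_plus _ _ _ (bigO_weaken _ 3 2 _ H3)
      (bigO_pow (- (d2 - c2))%C 2))); [|lia].
    intros z _. simpl. ring. }
  assert (H2 : (d2 - c2)%C = 0%C).
  { apply (bigO_monomial_zero _ 2). refine (bigO_ext _ _ _ _ H3).
    intros z _. rewrite H1. simpl. ring. }
  split; [replace d1 with (d1 - c1 + c1)%C by ring; rewrite H1
         |replace d2 with (d2 - c2 + c2)%C by ring; rewrite H2]; ring.
Qed.

(** Here [c1 = c] and [c2 = -(1 - c^2)]: equality in [|c2| <= 1 - |c1|^2], with [c2] pointing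
    against [c1^2] so that the reverse triangle inequality is sharp too. *)
Definition blaschke (c : R) (z : C) : C := (z * ((c - z) / (1 - c * z)))%C.

Definition blaschke_coef (c : R) (n : nat) : C :=
  match n with
  | O => 0
  | S O => c
  | S (S k) => (c ^ 2 - 1) * c ^ k
  end%R.

Lemma blaschke_denominator (c : R) (z : C) :
  0 <= c < 1 -> inD z -> 1 - c <= Cmod (1 - c * z).
Proof.
  intros Hc Hz. unfold inD in Hz.
  pose proof (Cmod_triangle (1 - c * z) (c * z)) as T.
  replace (1 - c * z + c * z)%C with (RtoC 1) in T by ring.
  rewrite Cmod_1, Cmod_mult, Cmod_R, (Rabs_pos_eq c) in T by lra.
  pose proof (Cmod_ge_0 z). nra.
Qed.

Lemma blaschke_denominator_neq_0 (c : R) (z : C) :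
  0 <= c < 1 -> inD z -> (1 - c * z)%C <> 0%C.
Proof.
  intros Hc Hz. apply Cmod_gt_0. pose proof (blaschke_denominator c z Hc Hz). lra.
Qed.

Lemma is_Cseries_geom (q : C) : Cmod q < 1 -> is_Cseries (fun n => q ^ n)%C (/ (1 - q))%C.
Proof.
  intros Hq.
  destruct (psum_of_bounded (fun _ => 1%C)) as [g Hg].
  { intros r Hr. exists 1. intros n. rewrite Cmod_1, Rmult_1_l.
    rewrite <- (pow1 n). apply pow_incr. lra. }
  specialize (Hg q Hq).
  assert (Hq1 : (1 - q)%C <> 0%C).
  { intros E. assert (q = 1%C) as -> by (replace q with (1 - (1 - q))%C by ring; rewrite E; ring).
    rewrite Cmod_1 in Hq. lra. }
  assert (E : (g q - 1 * q ^ 0)%C = (q * g q)%C).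
  { apply (is_Cseries_unique _ _ _ (is_Cseries_tail _ _ Hg)).
    refine (is_Cseries_congr _ _ _ _ _ eq_refl (is_Cseries_scal q _ _ Hg)).
    intros n. simpl. ring. }
  refine (is_Cseries_congr _ _ _ _ _ _ Hg).
  - intros n. ring.
  - transitivity ((g q - q * g q) / (1 - q))%C; [field; exact Hq1|].
    rewrite <- E. simpl. field. exact Hq1.
Qed.

Lemma psum_blaschke (c : R) : 0 <= c < 1 -> psum (blaschke_coef c) (blaschke c).
Proof.
  intros Hc z Hz.
  pose proof (blaschke_denominator_neq_0 c z Hc Hz) as Hn.
  assert (Hcz : Cmod (c * z) < 1).
  { rewrite Cmod_mult, Cmod_R, Rabs_pos_eq by lra. pose proof (Cmod_ge_0 z). unfold inD in Hz. nra. }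
  assert (Htail : is_Cseries (fun n => blaschke_coef c (S (S n)) * z ^ S (S n))%C
     ((c * c - 1) * z * z * / (1 - c * z))%C).
  { refine (is_Cseries_congr _ _ _ _ _ eq_refl
      (is_Cseries_scal ((c * c - 1) * z * z)%C _ _ (is_Cseries_geom _ Hcz))).
    intros n. rewrite Cpow_mult_l. simpl blaschke_coef.
    rewrite RtoC_mult, RtoC_minus, !RtoC_mult, RtoC_pow. simpl. ring. }
  refine (is_Cseries_congr _ _ _ _ (fun n => eq_refl) _
    (is_Cseries_cons _ _ (is_Cseries_cons _ _ Htail))).
  unfold blaschke. simpl. field. exact Hn.
Qed.

(** The identity [|1 - c z|^2 - |c - z|^2 = (1 - c^2)(1 - |z|^2)] bounds the quotient by 1;
    strictness comes from the extra factor [z]. *)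
Lemma blaschke_lt_1 (c : R) (z : C) : 0 <= c < 1 -> inD z -> Cmod (blaschke c z) < 1.
Proof.
  intros Hc Hz.
  pose proof (blaschke_denominator c z Hc Hz) as Hd.
  pose proof (blaschke_denominator_neq_0 c z Hc Hz) as Hn.
  unfold inD in Hz. pose proof (Cmod_ge_0 z) as Hz0.
  assert (Hsq : Cmod (c - z) ^ 2 <= Cmod (1 - c * z) ^ 2).
  { assert (E : Cmod (1 - c * z) ^ 2 - Cmod (c - z) ^ 2 = (1 - c ^ 2) * (1 - Cmod z ^ 2)).
    { rewrite !Cmod2_alt. destruct z as [x y]. simpl. ring. }
    assert (0 <= (1 - c ^ 2) * (1 - Cmod z ^ 2)) by (apply Rmult_le_pos; simpl; nra). lra. }
  assert (Hle : Cmod (c - z) <= Cmod (1 - c * z)).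
  { apply Rsqr_incr_0; [unfold Rsqr; simpl in Hsq; lra|apply Cmod_ge_0|apply Cmod_ge_0]. }
  unfold blaschke. rewrite Cmod_mult, Cmod_div by exact Hn.
  assert (Hq : Cmod (c - z) / Cmod (1 - c * z) <= 1).
  { apply Rmult_le_reg_r with (Cmod (1 - c * z)); [lra|].
    unfold Rdiv. rewrite Rmult_assoc, Rinv_l by lra. lra. }
  assert (0 <= Cmod (c - z) / Cmod (1 - c * z)).
  { apply Rmult_le_pos; [apply Cmod_ge_0|]. left. apply Rinv_0_lt_compat. lra. }
  nra.
Qed.

Lemma blaschke_expansion (c : R) :
  0 <= c < 1 -> bigO (fun z => blaschke c z - c * z - (c * c - 1) * z * z)%C 3.
Proof.
  intros Hc. exists (Cmod ((c * c - 1) * c) / (1 - c)), 1.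
  split; [lra|]. pose proof (Cmod_ge_0 ((c * c - 1) * c)) as H0.
  split; [apply Rmult_le_pos; [exact H0|left; apply Rinv_0_lt_compat; lra]|].
  intros z Hz. pose proof (blaschke_denominator c z Hc Hz) as Hd.
  pose proof (blaschke_denominator_neq_0 c z Hc Hz) as Hn.
  replace (blaschke c z - c * z - (c * c - 1) * z * z)%C
    with ((c * c - 1) * c * z ^ 3 * / (1 - c * z))%C
    by (unfold blaschke; simpl; field; exact Hn).
  rewrite Cmod_mult, Cmod_inv, (Cmod_mult _ (z ^ 3)), Cmod_pow by exact Hn.
  assert (/ Cmod (1 - c * z) <= / (1 - c)) by (apply Rinv_le_contravar; lra).
  unfold Rdiv. rewrite (Rmult_assoc _ (/ (1 - c))), (Rmult_comm (/ (1 - c))), <- Rmult_assoc.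
  apply Rmult_le_compat_l; [|assumption].
  apply Rmult_le_pos; [exact H0|apply pow_le, Cmod_ge_0].
Qed.

Lemma exists_Sch_blaschke (c : R) :
  0 <= c < 1 -> exists a f, in_Sch a f /\
    Cmod (gamma2 a) - Cmod (gamma1 a) = Rabs (3 / 2 * c ^ 2 - 1) / 4 - c / 2.
Proof.
  intros Hc.
  destruct (exists_Sch_of_schwarz (blaschke_coef c) (blaschke c)) as (a & f & HS & HO).
  - now apply psum_blaschke.
  - unfold blaschke. ring.
  - intros z Hz. now apply blaschke_lt_1.
  - exists a, f. split; [exact HS|].
    destruct (bigO_coef_unique _ _ _ _ _ HO (blaschke_expansion c Hc)) as [E1 E2].
    rewrite gamma2_eq, E2. unfold gamma1. rewrite E1.
    replace ((c * c - 1 + c * c / 2) / 4)%C with (RtoC ((3 / 2 * c ^ 2 - 1) / 4)).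
    2:{ unfold Rdiv. rewrite !RtoC_mult, RtoC_minus, !RtoC_mult, RtoC_pow, !RtoC_inv by lra.
        simpl. field. }
    replace (c / 2)%C with (RtoC (c / 2)) by (apply RtoC_div; lra).
    rewrite !Cmod_R, (Rabs_pos_eq (c / 2)) by lra.
    unfold Rdiv at 1. rewrite Rabs_mult, (Rabs_pos_eq (/ 4)) by lra. reflexivity.
Qed.

Theorem theorem4p1 :
  (forall (a : nat -> C) (f : C -> C), in_Sch a f ->
     - (1 / sqrt 6) <= Cmod (gamma2 a) - Cmod (gamma1 a) <= 1 / 4) /\
  (exists (a : nat -> C) (f : C -> C), in_Sch a f /\
     Cmod (gamma2 a) - Cmod (gamma1 a) = - (1 / sqrt 6)) /\
  (exists (a : nat -> C) (f : C -> C), in_Sch a f /\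
     Cmod (gamma2 a) - Cmod (gamma1 a) = 1 / 4).
Proof.
  split; [exact Sch_gamma_bounds|]. split.
  - destruct sqrt6_bounds as [H1 H2]. set (s := 1 / sqrt 6) in *.
    (* [2 s = sqrt (2/3)] is the zero of [3/2 c^2 - 1], so [gamma2] vanishes and only [-c/2 = -s] is
       left. *)
    destruct (exists_Sch_blaschke (2 * s)) as (a & f & HS & E); [simpl in H1; nra|].
    exists a, f. split; [exact HS|]. rewrite E.
    replace (3 / 2 * (2 * s) ^ 2 - 1) with 0 by (simpl in *; lra).
    rewrite Rabs_R0. field.
  (* Here [w(z) = -z^2], so [gamma1 = 0] and [|gamma2|] takes its largest value. *)
  - destruct (exists_Sch_blaschke 0) as (a & f & HS & E); [lra|].
    exists a, f. split; [exact HS|]. rewrite E.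
    replace (3 / 2 * 0 ^ 2 - 1) with (- (1)) by (simpl; ring).
    rewrite Rabs_Ropp, Rabs_R1. field.
Qed.
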